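(* Let $\widehat{\mathfrak g}$ be of type $A_{n-1}^{(1)}$ ($n\ge3$), $D_n^{(1)}$ ($n\ge4$) or $E_6^{(1)}$. The two-parameter quantum affine algebra $U=U_{r,s}(\widehat{\mathfrak g})$ is isomorphic to the Drinfeld quantum double $\mathcal D(\widehat{\mathcal B},\widehat{\mathcal B}')$, formed with respect to the skew-dual pairing $\langle\,,\rangle:\widehat{\mathcal B}'\times\widehat{\mathcal B}\to\mathbb K$ described in the context.
   Context: **Ground data.** $\mathbb K$ is an algebraically closed field containing $\mathbb Q(r,s)$, with $r,s$ nonzero complex numbers, $r^2\ne s^2$. $I=\{1,\dots,n-1\}$, $\{1,\dots,n\}$, $\{1,\dots,6\}$ for types $A_{n-1},D_n,E_6$; $I_0=I\cup\{0\}$; $(a_{ij})_{i,j\in I_0}$ is the affine Cartan matrix; $c$ is the canonical central element of $\widehat{\mathfrak g}$. Dynkin edges on $I$: $\{i,i+1\}$ for $A_{n-1}$; $\{i,i+1\}$ ($1\le i\le n-2$) and $\{n-2,n\}$ for $D_n$; $\{1,3\},\{3,4\},\{4,5\},\{5,6\},\{2,4\}$ for $E_6$. Node $0$ is joined to $1$ and $n-1$ ($A_{n-1}^{(1)}$), to $2$ ($D_n^{(1)}$), to $2$ ($E_6^{(1)}$). $\delta=\alpha_0+\theta$ is the primitive imaginary root, $\theta$ the highest root of $\mathfrak g$; for $\delta=\sum_{i\in I_0}m_i\alpha_i$ put $\omega_\delta=\prod_i\omega_i^{m_i}$, $\omega'_\delta=\prod_i\omega_i'^{m_i}$. **Structure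 constants.** $\langle i,i\rangle=rs^{-1}$ for $i\in I_0$. For $i,j\in I$: if $i<j$ and $a_{ij}=-1$, then $\langle i,j\rangle=r^{-1}$, $\langle j,i\rangle=s$; in type $D_n$, $\langle n-1,n\rangle=(rs)^{-1}$, $\langle n,n-1\rangle=rs$; otherwise $\langle i,j\rangle=1$ for $i\ne j$. For index $0$: type $A_{n-1}$: $\langle0,1\rangle=r^{-1}$, $\langle1,0\rangle=s$, $\langle0,n-1\rangle=s$, $\langle n-1,0\rangle=r^{-1}$; type $D_n$: $\langle0,1\rangle=(rs)^{-1}$, $\langle1,0\rangle=rs$, $\langle0,2\rangle=r^{-1}$, $\langle2,0\rangle=s$, $\langle0,n\rangle=(rs)^2$, $\langle n,0\rangle=(rs)^{-2}$; type $E_6$: $(\langle0,j\rangle)_{j=1}^6=((rs)^{-1},r^{-2}s^{-1},(rs)^{-1},rs,rs,rs)$, $(\langle j,0\rangle)_{j=1}^6=(rs,rs^2,rs,(rs)^{-1},(rs)^{-1},(rs)^{-1})$; all others are $1$. **The algebra.** $U$ is the unital associative $\mathbb K$-algebra generated by $e_j,f_j,\omega_j^{\pm1},\omega_j'^{\pm1}$ ($j\in I_0$), $\gamma^{\pm\frac12},\gamma'^{\pm\frac12},D^{\pm1},D'^{\pm1}$ with relations: - $\gamma^{\pm\frac12},\gamma'^{\pm\frac12}$ are central with $\gamma=\omega_\delta'^{-1}$, $\gamma'=\omega_\delta^{-1}$, $\gamma\gamma'=(rs)^c$; $\omega_i\omega_i^{-1}=\omega_i'\omega_i'^{-1}=1=DD^{-1}=D'D'^{-1}$;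 all $\omega_i^{\pm1},\omega_j'^{\pm1},D^{\pm1},D'^{\pm1}$ commute with each other. - $De_iD^{-1}=r^{\delta_{0i}}e_i$, $Df_iD^{-1}=r^{-\delta_{0i}}f_i$, $\omega_je_i\omega_j^{-1}=\langle i,j\rangle e_i$, $\omega_jf_i\omega_j^{-1}=\langle i,j\rangle^{-1}f_i$. - $D'e_iD'^{-1}=s^{\delta_{0i}}e_i$, $D'f_iD'^{-1}=s^{-\delta_{0i}}f_i$, $\omega_j'e_i\omega_j'^{-1}=\langle j,i\rangle^{-1}e_i$, $\omega_j'f_i\omega_j'^{-1}=\langle j,i\rangle f_i$. - $[e_i,f_j]=\frac{\delta_{ij}}{r-s}(\omega_i-\omega_i')$. - For $i\neq j$, $(\mathrm{ad}_le_i)^{1-a_{ij}}(e_j)=0$ and $(\mathrm{ad}_rf_i)^{1-a_{ij}}(f_j)=0$, where $\mathrm{ad}_l\,a(b)=\sum a_{(1)}bS(a_{(2)})$, $\mathrm{ad}_r\,a(b)=\sum S(a_{(1)})ba_{(2)}$, that is, $\mathrm{ad}_le_i(b)=e_ib-\omega_ib\omega_i^{-1}e_i$ and $\mathrm{ad}_rf_i(b)=bf_i-f_i\omega_i'^{-1}b\omega_i'$. It is a Hopf algebra with $\omega_i^{\pm1},\omega_i'^{\pm1}$ group-like, $\Delta(e_i)=e_i\otimes1+\omega_i\otimes e_i$, $\Delta(f_i)=1\otimes f_i+f_i\otimes\omega_i'$, $\varepsilon(\omega_i^{\pm1})=\varepsilon(\omega_i'^{\pm1})=1$, $\varepsilon(e_i)=\varepsilon(f_i)=0$,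 $S(\omega_i^{\pm1})=\omega_i^{\mp1}$, $S(\omega_i'^{\pm1})=\omega_i'^{\mp1}$, $S(e_i)=-\omega_i^{-1}e_i$, $S(f_i)=-f_i\omega_i'^{-1}$. $\widehat{\mathcal B}$ (resp. $\widehat{\mathcal B}'$) is the Hopf subalgebra of $U$ generated by all $e_j,\omega_j^{\pm1}$ (resp. $f_j,\omega_j'^{\pm1}$), $j\in I_0$. **Pairing.** A skew-dual pairing of Hopf algebras $\mathcal A,\mathcal U$ is a bilinear form $\langle\,,\rangle:\mathcal U\times\mathcal A\to\mathbb K$ with $\langle f,1\rangle=\varepsilon(f)$, $\langle1,a\rangle=\varepsilon(a)$, $\langle f,a_1a_2\rangle=\langle\Delta^{\mathrm{op}}(f),a_1\otimes a_2\rangle$, $\langle f_1f_2,a\rangle=\langle f_1\otimes f_2,\Delta(a)\rangle$. There is a unique skew-dual pairing $\widehat{\mathcal B}'\times\widehat{\mathcal B}\to\mathbb K$ with $\langle f_i,e_j\rangle=\frac{\delta_{ij}}{s-r}$, $\langle\omega_i',\omega_j\rangle=\langle i,j\rangle$, $\langle\omega_i'^{\pm1},\omega_j^{-1}\rangle=\langle\omega_i'^{\pm1},\omega_j\rangle^{-1}=\langle i,j\rangle^{\mp1}$, and all other pairs of generators pairing to $0$. **Double.** $\mathcal D(\mathcal A,\mathcal U)$ is the Hopf algebra with underlying coalgebra $\mathcal A\otimes\mathcal U$ (tensor product coalgebra), product $(a\otimes f)(a'\otimes f')=\sum\langle S_{\mathcal U}(f_{(1)}),a'_{(1)}\rangle\langle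 f_{(3)},a'_{(3)}\rangle\,aa'_{(2)}\otimes f_{(2)}f'$ and antipode $S(a\otimes f)=(1\otimes S_{\mathcal U}(f))(S_{\mathcal A}(a)\otimes1)$.
   Formalization: U is replaced by its subalgebra generated by all e_j, f_j, ω_j^{±1}, ω'_j^{±1} (without D, D', γ^{1/2}, γ'^{1/2}); with the given B, B' the claim for full U is false, since the largest commutative quotient of U has larger Krull dimension than that of the double. *)

(* Defs.v *)
From HB Require Import structures.
From mathcomp Require Import all_boot all_order all_algebra.
From mathcomp Require Import boolp.

Set Implicit Arguments.
Unset Strict Implicit.
Unset Printing Implicit Defensive.

Import GRing.Theory.
Local Open Scope ring_scope.
Local Open Scope quotient_scope.

(* -------------------------------------------------------------------- *)
(* Tensor product of two vector spaces.                                 *)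

(* A formal sum [:: (v1, w1); ...; (vk, wk)] stands for the sum of the
   v_i (x) w_i; two formal sums are identified when no bilinear map can
   tell them apart. *)
Section Tensor.
Variables (K : fieldType) (V W : lmodType K).

Definition tens_eval (L : lmodType K) (b : V -> W -> L) (s : seq (V * W)) : L :=
  \sum_(p <- s) b p.1 p.2.

Definition tens_eq (s t : seq (V * W)) : Prop :=
  forall (L : lmodType K) (b : V -> W -> L),
    bilinear_for *:%R *:%R b -> tens_eval b s = tens_eval b t.

Definition tens_eqb (s t : seq (V * W)) : bool := `[< tens_eq s t >].

Fact tens_eqb_equiv : equiv_class_of tens_eqb.
Proof.
split=> [s|s t|s t u].
- exact/asboolP.
- by apply/asboolP/asboolP => h L b hb; rewrite h.
- by move=> /asboolP h1 /asboolP h2; apply/asboolP => L b hb; rewrite h1 ?h2.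
Qed.

Canonical tens_equiv := EquivRelPack tens_eqb_equiv.

Definition tens := {eq_quot tens_equiv}.
HB.instance Definition _ := Choice.on tens.
HB.instance Definition _ := EqQuotient.on tens.

Definition tens_cls (s : seq (V * W)) : tens := \pi s.
Definition tensor (v : V) (w : W) : tens := tens_cls [:: (v, w)].

(* For a bilinear [b], the linear map sending [tensor v w] to [b v w]. *)
Definition tlift (L : lmodType K) (b : V -> W -> L) (x : tens) : L :=
  tens_eval b (repr x).

Lemma tlift_pi (L : lmodType K) (b : V -> W -> L) s :
  bilinear_for *:%R *:%R b -> tlift b (tens_cls s) = tens_eval b s.
Proof.
move=> hb; have /eqmodP/asboolP h : repr (tens_cls s) = s %[mod tens].
  by rewrite reprK.
exact: h.
Qed.

Lemma tensP (x y : tens) :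
  (forall (L : lmodType K) (b : V -> W -> L),
     bilinear_for *:%R *:%R b -> tlift b x = tlift b y) -> x = y.
Proof.
move=> h; rewrite -[x]reprK -[y]reprK.
by apply/eqmodP/asboolP => L b hb; apply: h.
Qed.

Let tzero : tens := tens_cls [::].
Let topp (x : tens) : tens := tens_cls [seq (- p.1, p.2) | p <- repr x].
Let tadd (x y : tens) : tens := tens_cls (repr x ++ repr y).
Let tscale (k : K) (x : tens) : tens := tens_cls [seq (k *: p.1, p.2) | p <- repr x].

Section Eval.
Variables (L : lmodType K) (b : V -> W -> L).
Hypothesis hb : bilinear_for *:%R *:%R b.

Let bZl k v w : b (k *: v) w = k *: b v w.
Proof.
have h0 : b 0 w = 0.
  by have := hb.1 w (- 1) 0 0; rewrite /= scaler0 addr0 scaleN1r addNr.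
by have := hb.1 w k v 0; rewrite /= addr0 h0 addr0.
Qed.

Let tlift0 : tlift b tzero = 0.
Proof. by rewrite /tzero tlift_pi // /tens_eval big_nil. Qed.

Let tliftD x y : tlift b (tadd x y) = tlift b x + tlift b y.
Proof. by rewrite /tadd tlift_pi // /tens_eval big_cat. Qed.

Let tliftZ k x : tlift b (tscale k x) = k *: tlift b x.
Proof.
rewrite /tscale tlift_pi // /tlift /tens_eval big_map scaler_sumr.
by apply: eq_bigr => p _; rewrite bZl.
Qed.

Let tliftN x : tlift b (topp x) = - tlift b x.
Proof.
rewrite /topp tlift_pi // /tlift /tens_eval big_map -sumrN.
by apply: eq_bigr => p _ /=; have := bZl (- 1) p.1 p.2; rewrite !scaleN1r.
Qed.

Definition tens_evalE := (tlift0, tliftD, tliftZ, tliftN).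
End Eval.

Let taddA : associative tadd.
Proof. by move=> x y z; apply: tensP => L b hb; rewrite !tens_evalE // addrA. Qed.
Let taddC : commutative tadd.
Proof. by move=> x y; apply: tensP => L b hb; rewrite !tens_evalE // addrC. Qed.
Let tadd0 : left_id tzero tadd.
Proof. by move=> x; apply: tensP => L b hb; rewrite !tens_evalE // add0r. Qed.
Let taddN : left_inverse tzero topp tadd.
Proof. by move=> x; apply: tensP => L b hb; rewrite !tens_evalE // addNr. Qed.

HB.instance Definition _ := GRing.isZmodule.Build tens taddA taddC tadd0 taddN.

Let tscaleA a c v : tscale a (tscale c v) = tscale (a * c) v.
Proof. by apply: tensP => L b hb; rewrite !tens_evalE // scalerA. Qed.
Let tscale1 : left_id 1 tscale.
Proof. by move=> x; apply: tensP => L b hb; rewrite !tens_evalE // scale1r. Qed.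
Let tscaleDr : right_distributive tscale +%R.
Proof.
move=> k x y; apply: tensP => L b hb.
by rewrite !tens_evalE // scalerDr.
Qed.
Let tscaleDl v : {morph tscale^~ v : a c / a + c}.
Proof.
move=> a c; apply: tensP => L b hb.
by rewrite !tens_evalE // scalerDl.
Qed.

HB.instance Definition _ := GRing.Zmodule_isLmodule.Build K tens
  tscaleA tscale1 tscaleDr tscaleDl.

Lemma tlift_tensor (L : lmodType K) (b : V -> W -> L) v w :
  bilinear_for *:%R *:%R b -> tlift b (tensor v w) = b v w.
Proof. by move=> hb; rewrite tlift_pi // /tens_eval big_seq1. Qed.

Lemma tlift_linear (L : lmodType K) (b : V -> W -> L) :
  bilinear_for *:%R *:%R b -> linear (tlift b).
Proof. by move=> hb k x y; rewrite !tens_evalE. Qed.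

Lemma tensor_bilinear : bilinear_for *:%R *:%R tensor.
Proof.
split=> [w k v v'|v k w w']; apply: tensP => L b hb;
  rewrite !tens_evalE // !tlift_tensor //.
- exact: hb.1.
- exact: hb.2.
Qed.

End Tensor.

Section TensorMaps.
Variable K : fieldType.

Definition tmap (V W V' W' : lmodType K) (f : V -> V') (g : W -> W') :
    tens V W -> tens V' W' :=
  tlift (fun v w => tensor (f v) (g w)).

Definition tassoc (V W X : lmodType K) :
    tens (tens V W) X -> tens V (tens W X) :=
  tlift (fun (u : tens V W) x => tlift (fun v w => tensor v (tensor w x)) u).

Definition tlift3 (V W X L : lmodType K) (b : V -> W -> X -> L) :
    tens (tens V W) X -> L :=
  tlift (fun (u : tens V W) x => tlift (fun v w => b v w x) u).

Definition tmul (A B : algType K) (x y : tens A B) : tens A B :=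
  tlift (fun a b => tlift (fun a' b' => tensor (a * a') (b * b')) y) x.

End TensorMaps.

(* -------------------------------------------------------------------- *)
(* Hopf algebras.                                                       *)

Section Hopf.
Variable K : fieldType.

Record hopfAlg (A : algType K) := HopfAlg {
  cop : A -> tens A A;
  eps : A -> K;
  ant : A -> A;
  _ : linear cop;
  _ : scalar eps;
  _ : linear ant;
  _ : forall x, tassoc (tmap cop id (cop x)) = tmap id cop (cop x);
  _ : forall x, tlift (fun a b => eps a *: b) (cop x) = x;
  _ : forall x, tlift (fun a b => eps b *: a) (cop x) = x;
  _ : cop 1 = tensor 1 1;
  _ : forall x y, cop (x * y) = tmul (cop x) (cop y);
  _ : eps 1 = 1;
  _ : forall x y, eps (x * y) = eps x * eps y;
  _ : forall x, tlift (fun a b => ant a * b) (cop x) = (eps x)%:A;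
  _ : forall x, tlift (fun a b => a * ant b) (cop x) = (eps x)%:A }.

Record hopfOps (V : lmodType K) := HopfOps {
  ho_mul : V -> V -> V;
  ho_one : V;
  ho_cop : V -> tens V V;
  ho_eps : V -> K;
  ho_ant : V -> V }.

Definition ops_of (A : algType K) (H : hopfAlg A) : hopfOps A :=
  HopfOps *%R 1 (cop H) (eps H) (ant H).

Definition hopf_isomorphic (V W : lmodType K) (h : hopfOps V) (h' : hopfOps W)
  : Prop :=
  exists phi : {linear V -> W},
    [/\ bijective phi,
        phi (ho_one h) = ho_one h'
          /\ (forall x y, phi (ho_mul h x y) = ho_mul h' (phi x) (phi y)),
        forall x, ho_cop h' (phi x) = tmap phi phi (ho_cop h x),
        forall x, ho_eps h' (phi x) = ho_eps h x
      & forall x, ho_ant h' (phi x) = phi (ho_ant h x)].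

Definition skew_dual_pairing (A U : algType K) (HA : hopfAlg A)
    (HU : hopfAlg U) (p : U -> A -> K) : Prop :=
  [/\ bilinear_for *%R *%R (p : U -> A -> K^o),
      forall f, p f 1 = eps HU f,
      forall a, p 1 a = eps HA a,
      forall f a1 a2, p f (a1 * a2) =
        tlift (fun f1 f2 => (p f2 a1 * p f1 a2 : K^o)) (cop HU f)
    & forall f1 f2 a, p (f1 * f2) a =
        tlift (fun a1 a2 => (p f1 a1 * p f2 a2 : K^o)) (cop HA a)].

Section Double.
Variables (A U : algType K) (HA : hopfAlg A) (HU : hopfAlg U).
Variable p : U -> A -> K.

Definition cop2 (B : algType K) (H : hopfAlg B) (x : B) :
    tens (tens B B) B :=
  tmap (cop H) id (cop H x).

Definition double_mul (x y : tens A U) : tens A U :=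
  tlift (fun a f =>
    tlift (fun a' f' =>
      tlift3 (fun f1 f2 f3 =>
        tlift3 (fun a1 a2 a3 =>
          (p (ant HU f1) a1 * p f3 a3) *: tensor (a * a2) (f2 * f'))
        (cop2 HA a'))
      (cop2 HU f))
    y) x.

Definition double_cop (x : tens A U) : tens (tens A U) (tens A U) :=
  tlift (fun a f =>
    tlift (fun a1 a2 =>
      tlift (fun f1 f2 => tensor (tensor a1 f1) (tensor a2 f2)) (cop HU f))
    (cop HA a)) x.

Definition double_eps (x : tens A U) : K :=
  tlift (fun a f => (eps HA a * eps HU f : K^o)) x.

Definition double_ant (x : tens A U) : tens A U :=
  tlift (fun a f =>
    double_mul (tensor 1 (ant HU f)) (tensor (ant HA a) 1)) x.

Definition drinfeld_double : hopfOps (tens A U) :=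
  HopfOps double_mul (tensor 1 1) double_cop double_eps double_ant.

End Double.
End Hopf.

(* -------------------------------------------------------------------- *)
(* Affine data.                                                         *)

(* [AffA n] is A_{n-1}^(1), [AffD n] is D_n^(1), [AffE6] is E_6^(1). *)
Inductive aff_type := AffA of nat | AffD of nat | AffE6.

Definition aff_ok (t : aff_type) : bool :=
  match t with AffA n => 3 <= n | AffD n => 4 <= n | AffE6 => true end%N.

(* I_0 = {0, ..., (size_I t)}, realised as 'I_(size_I t).+1. *)
Definition size_I (t : aff_type) : nat :=
  match t with AffA n => n.-1 | AffD n => n | AffE6 => 6 end.

Notation node t := 'I_(size_I t).+1.

Definition edge (t : aff_type) (i j : nat) : bool :=
  match t with
  | AffA n =>
      (0 < i) && (j == i.+1) || (i == 0) && ((j == 1) || (j == n.-1))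
  | AffD n =>
      [|| [&& 0 < i, i <= n - 2 & j == i.+1],
          (i == n - 2) && (j == n) | (i == 0) && (j == 2)]
  | AffE6 =>
      (i, j) \in [:: (1, 3); (3, 4); (4, 5); (5, 6); (2, 4); (0, 2)]%N
  end%N.

Definition adj (t : aff_type) (i j : nat) : bool := edge t i j || edge t j i.

Definition cartan (t : aff_type) (i j : nat) : int :=
  if i == j then 2 else if adj t i j then -1 else 0.

(* The coordinates of delta = alpha_0 + theta. *)
Definition mark (t : aff_type) (i : nat) : nat :=
  match t with
  | AffA _ => 1
  | AffD n => if (i <= 1) || (n.-1 <= i) then 1 else 2
  | AffE6 => nth 0 [:: 1; 1; 2; 2; 3; 2; 1] i
  end%N.

Section StructureConstants.
Variables (K : fieldType) (t : aff_type) (r s : K).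

(* <i,j> for distinct i, j in I *)
Definition sc_fin (i j : nat) : K :=
  if adj t i j then (if (i < j)%N then r^-1 else s)
  else if t is AffD n then
    if (i == n.-1) && (j == n) then (r * s)^-1
    else if (i == n) && (j == n.-1) then r * s
    else 1
  else 1.

(* <0,j> for j in I *)
Definition sc_row0 (j : nat) : K :=
  match t with
  | AffA n => if j == 1%N then r^-1 else if j == n.-1 then s else 1
  | AffD n => if j == 1%N then (r * s)^-1 else if j == 2%N then r^-1
              else if j == n then (r * s) ^+ 2 else 1
  | AffE6 => nth 1 [:: (r * s)^-1; r ^- 2 * s^-1; (r * s)^-1;
                       r * s; r * s; r * s] j.-1
  end.

(* <j,0> for j in I *)
Definition sc_col0 (j : nat) : K :=
  match t with
  | AffA n => if j == 1%N then s else if j == n.-1 then r^-1 else 1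
  | AffD n => if j == 1%N then r * s else if j == 2%N then s
              else if j == n then (r * s) ^- 2 else 1
  | AffE6 => nth 1 [:: r * s; r * s ^+ 2; r * s;
                       (r * s)^-1; (r * s)^-1; (r * s)^-1] j.-1
  end.

Definition sc (i j : nat) : K :=
  if i == j then r / s
  else if i == 0%N then sc_row0 j
  else if j == 0%N then sc_col0 i
  else sc_fin i j.

End StructureConstants.

(* -------------------------------------------------------------------- *)
(* The algebra U_{r,s}.                                                 *)

(* A trailing V marks the generator standing for the inverse; [ga] and [ga']
   are gamma^(1/2) and gamma'^(1/2). *)
Inductive gen (t : aff_type) :=
  | ge of node t | gf of node t
  | gw of node t | gwV of node t | gw' of node t | gwV' of node t
  | ga | gaV | ga' | gaV'
  | gD | gDV | gD' | gDV'.

Arguments ga {t}. Arguments gaV {t}. Arguments ga' {t}. Arguments gaV' {t}.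
Arguments gD {t}. Arguments gDV {t}. Arguments gD' {t}. Arguments gDV' {t}.

Definition toral (t : aff_type) (g : gen t) : bool :=
  match g with
  | gw _ | gwV _ | gw' _ | gwV' _ | gD | gDV | gD' | gDV' => true
  | _ => false
  end.

Definition is_ga (t : aff_type) (g : gen t) : bool :=
  match g with ga | gaV | ga' | gaV' => true | _ => false end.

Section Relations.
Variables (K : fieldType) (t : aff_type) (r s : K).
Variables (A : algType K) (x : gen t -> A).

Definition ad_l (i : node t) (b : A) : A :=
  x (ge i) * b - x (gw i) * b * x (gwV i) * x (ge i).

Definition ad_r (i : node t) (b : A) : A :=
  b * x (gf i) - x (gf i) * x (gwV' i) * b * x (gw' i).

(* The equation gamma gamma' = (rs)^c is not listed: (rs)^c is a name for the
   central element gamma gamma'. *)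
Record qaff_rel : Prop := QAffRel {
  rel_inv_w : forall i, x (gw i) * x (gwV i) = 1 /\ x (gwV i) * x (gw i) = 1;
  rel_inv_w' : forall i,
    x (gw' i) * x (gwV' i) = 1 /\ x (gwV' i) * x (gw' i) = 1;
  rel_inv_D : x gD * x gDV = 1 /\ x gDV * x gD = 1;
  rel_inv_D' : x gD' * x gDV' = 1 /\ x gDV' * x gD' = 1;
  rel_inv_ga : x ga * x gaV = 1 /\ x gaV * x ga = 1;
  rel_inv_ga' : x ga' * x gaV' = 1 /\ x gaV' * x ga' = 1;
  rel_central : forall g h, is_ga g -> x g * x h = x h * x g;
  rel_gamma : x ga ^+ 2 = \prod_(i : node t) x (gwV' i) ^+ mark t i;
  rel_gamma' : x ga' ^+ 2 = \prod_(i : node t) x (gwV i) ^+ mark t i;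
  rel_toral : forall g h, toral g -> toral h -> x g * x h = x h * x g;
  rel_De : forall i : node t,
    x gD * x (ge i) * x gDV = r ^+ (i == ord0) *: x (ge i);
  rel_Df : forall i : node t,
    x gD * x (gf i) * x gDV = r ^- (i == ord0) *: x (gf i);
  rel_we : forall i j : node t,
    x (gw j) * x (ge i) * x (gwV j) = sc t r s i j *: x (ge i);
  rel_wf : forall i j : node t,
    x (gw j) * x (gf i) * x (gwV j) = (sc t r s i j)^-1 *: x (gf i);
  rel_De' : forall i : node t,
    x gD' * x (ge i) * x gDV' = s ^+ (i == ord0) *: x (ge i);
  rel_Df' : forall i : node t,
    x gD' * x (gf i) * x gDV' = s ^- (i == ord0) *: x (gf i);
  rel_we' : forall i j : node t,
    x (gw' j) * x (ge i) * x (gwV' j) = (sc t r s j i)^-1 *: x (ge i);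
  rel_wf' : forall i j : node t,
    x (gw' j) * x (gf i) * x (gwV' j) = sc t r s j i *: x (gf i);
  rel_ef : forall i j : node t,
    x (ge i) * x (gf j) - x (gf j) * x (ge i) =
      ((i == j)%:R / (r - s)) *: (x (gw i) - x (gw' i));
  rel_serre_e : forall i j : node t, i != j ->
    iter (absz (1 - cartan t i j)) (ad_l i) (x (ge j)) = 0;
  rel_serre_f : forall i j : node t, i != j ->
    iter (absz (1 - cartan t i j)) (ad_r i) (x (gf j)) = 0 }.

End Relations.

Section PresentedAlgebra.
Variables (K : fieldType) (t : aff_type) (r s : K).

Inductive term :=
  | TGen of gen t | TCst of K | TAdd of term & term | TMul of term & term.

Fixpoint teval (A : algType K) (x : gen t -> A) (u : term) : A :=
  match u with
  | TGen g => x g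
  | TCst k => k%:A
  | TAdd u1 u2 => teval x u1 + teval x u2
  | TMul u1 u2 => teval x u1 * teval x u2
  end.

(* U is the algebra of noncommutative polynomial expressions in the
   generators, two of them being equal when they take the same value in every
   algebra in which the defining relations hold. *)
Definition term_eq (u v : term) : Prop :=
  forall (A : algType K) (x : gen t -> A),
    qaff_rel r s x -> teval x u = teval x v.

Definition cterm := {classic term}.
Definition term_eqb (u v : cterm) : bool := `[< term_eq u v >].

Fact term_eqb_equiv : equiv_class_of term_eqb.
Proof.
split=> [u|u v|u v w].
- exact/asboolP.
- by apply/asboolP/asboolP => h A x hx; rewrite h.
- by move=> /asboolP h1 /asboolP h2; apply/asboolP => A x hx; rewrite h1 ?h2.
Qed.

Canonical term_equiv := EquivRelPack term_eqb_equiv.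

Definition Uq := {eq_quot term_equiv}.
HB.instance Definition _ := Choice.on Uq.
HB.instance Definition _ := EqQuotient.on Uq.

Definition Ucls (u : cterm) : Uq := \pi u.
Definition Ugen (g : gen t) : Uq := Ucls (TGen g).

Definition Ueval (A : algType K) (x : gen t -> A) (a : Uq) : A :=
  teval x (repr a : cterm).

Lemma Ueval_cls (A : algType K) (x : gen t -> A) u :
  qaff_rel r s x -> Ueval x (Ucls u) = teval x u.
Proof.
move=> hx; have /eqmodP/asboolP h : repr (Ucls u) = (u : cterm) %[mod Uq].
  by rewrite reprK.
exact: h.
Qed.

Lemma UevalP (a b : Uq) :
  (forall (A : algType K) (x : gen t -> A),
     qaff_rel r s x -> Ueval x a = Ueval x b) -> a = b.
Proof.
move=> h; rewrite -[a]reprK -[b]reprK.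
by apply/eqmodP/asboolP => A x hx; apply: h.
Qed.

Let uzero : Uq := Ucls (TCst 0).
Let uone : Uq := Ucls (TCst 1).
Let uadd (a b : Uq) : Uq := Ucls (TAdd (repr a) (repr b)).
Let umul (a b : Uq) : Uq := Ucls (TMul (repr a) (repr b)).
Let uscale (k : K) (a : Uq) : Uq := Ucls (TMul (TCst k) (repr a)).
Let uopp (a : Uq) : Uq := uscale (- 1) a.

Section Eval.
Variables (A : algType K) (x : gen t -> A).
Hypothesis hx : qaff_rel r s x.

Let eval0 : Ueval x uzero = 0.
Proof. by rewrite Ueval_cls //= scale0r. Qed.
Let eval1 : Ueval x uone = 1.
Proof. by rewrite Ueval_cls //= scale1r. Qed.
Let evalD a b : Ueval x (uadd a b) = Ueval x a + Ueval x b.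
Proof. by rewrite Ueval_cls. Qed.
Let evalM a b : Ueval x (umul a b) = Ueval x a * Ueval x b.
Proof. by rewrite Ueval_cls. Qed.
Let evalZ k a : Ueval x (uscale k a) = k *: Ueval x a.
Proof. by rewrite Ueval_cls //= mulr_algl. Qed.
Let evalN a : Ueval x (uopp a) = - Ueval x a.
Proof. by rewrite evalZ scaleN1r. Qed.

Definition UevalE := (eval0, eval1, evalN, evalD, evalM, evalZ).
End Eval.

Let uaddA : associative uadd.
Proof. by move=> a b c; apply: UevalP => A x hx; rewrite !UevalE // addrA. Qed.
Let uaddC : commutative uadd.
Proof. by move=> a b; apply: UevalP => A x hx; rewrite !UevalE // addrC. Qed.
Let uadd0 : left_id uzero uadd.
Proof. by move=> a; apply: UevalP => A x hx; rewrite !UevalE // add0r. Qed.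
Let uaddN : left_inverse uzero uopp uadd.
Proof. by move=> a; apply: UevalP => A x hx; rewrite !UevalE // addNr. Qed.

HB.instance Definition _ := GRing.isZmodule.Build Uq uaddA uaddC uadd0 uaddN.

Let umulA : associative umul.
Proof. by move=> a b c; apply: UevalP => A x hx; rewrite !UevalE // mulrA. Qed.
Let umul1l : left_id uone umul.
Proof. by move=> a; apply: UevalP => A x hx; rewrite !UevalE // mul1r. Qed.
Let umul1r : right_id uone umul.
Proof. by move=> a; apply: UevalP => A x hx; rewrite !UevalE // mulr1. Qed.
Let umulDl : left_distributive umul +%R.
Proof. by move=> a b c; apply: UevalP => A x hx; rewrite !UevalE // mulrDl. Qed.
Let umulDr : right_distributive umul +%R.
Proof. by move=> a b c; apply: UevalP => A x hx; rewrite !UevalE // mulrDr. Qed.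

Let triv (g : gen t) : K^o := match g with ge _ | gf _ => 0 | _ => 1 end.

Let triv_rel : qaff_rel r s triv.
Proof.
split=> //=; rewrite ?mulr1 ?mul1r ?mulr0 ?mul0r ?scaler0 //.
all: try by rewrite expr2 mulr1 big1 // => i _; elim: (mark t i) => // n IH; rewrite exprS IH mulr1.
all: try by move=> *; exact: (mulrC (_ : K)).
all: try by move=> *; rewrite ?mulr0 ?mul0r ?scaler0 ?subrr ?scaler0 ?mulr1.
- by move=> i j _; elim: (absz _) => //= n ->;
    rewrite /ad_l /= ?mulr0 ?mul0r ?subrr.
- by move=> i j _; elim: (absz _) => //= n ->;
    rewrite /ad_r /= ?mulr0 ?mul0r ?subrr.
Qed.

Let uone_neq0 : uone != 0.
Proof.
apply/eqP => h; have := congr1 (Ueval triv) h.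
by rewrite !(UevalE triv_rel) => /eqP; rewrite oner_eq0.
Qed.

HB.instance Definition _ := GRing.Zmodule_isNzRing.Build Uq
  umulA umul1l umul1r umulDl umulDr uone_neq0.

Let uscaleA a c v : uscale a (uscale c v) = uscale (a * c) v.
Proof. by apply: UevalP => A x hx; rewrite !UevalE // scalerA. Qed.
Let uscale1 : left_id 1 uscale.
Proof. by move=> a; apply: UevalP => A x hx; rewrite !UevalE // scale1r. Qed.
Let uscaleDr : right_distributive uscale +%R.
Proof. by move=> k a b; apply: UevalP => A x hx; rewrite !UevalE // scalerDr. Qed.
Let uscaleDl v : {morph uscale^~ v : a c / a + c}.
Proof. by move=> a c; apply: UevalP => A x hx; rewrite !UevalE // scalerDl. Qed.

HB.instance Definition _ := GRing.Zmodule_isLmodule.Build K Uq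
  uscaleA uscale1 uscaleDr uscaleDl.

Let uscaleAl (k : K) (a b : Uq) : k *: (a * b) = (k *: a) * b.
Proof. by apply: UevalP => A x hx; rewrite !UevalE // scalerAl. Qed.

HB.instance Definition _ := GRing.Lmodule_isLalgebra.Build K Uq uscaleAl.

Let uscaleAr (k : K) (a b : Uq) : k *: (a * b) = a * (k *: b).
Proof. by apply: UevalP => A x hx; rewrite !UevalE // scalerAr. Qed.

HB.instance Definition _ := GRing.Lalgebra_isAlgebra.Build K Uq uscaleAr.


Lemma Ueval_gen (A : algType K) (x : gen t -> A) g :
  qaff_rel r s x -> Ueval x (Ugen g) = x g.
Proof. by move=> hx; rewrite Ueval_cls. Qed.

Lemma Ueval_linear (A : algType K) (x : gen t -> A) :
  qaff_rel r s x -> linear (Ueval x).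
Proof. by move=> hx k a b; rewrite !UevalE. Qed.

Lemma Ueval_monoid (A : algType K) (x : gen t -> A) :
  qaff_rel r s x -> monoid_morphism (Ueval x).
Proof. by move=> hx; split=> [|a b]; rewrite UevalE. Qed.

Lemma Ugen_rel : qaff_rel r s Ugen.
Proof.
have eM A x (hx : @qaff_rel K t r s A x) := (Ueval_monoid hx).2.
have e1 A x (hx : @qaff_rel K t r s A x) := (Ueval_monoid hx).1.
have e0 A x (hx : @qaff_rel K t r s A x) : Ueval x 0 = 0 by rewrite UevalE.
have eZ A x (hx : @qaff_rel K t r s A x) k a :
  Ueval x (k *: a) = k *: Ueval x a by rewrite UevalE.
have eB A x (hx : @qaff_rel K t r s A x) a b :
  Ueval x (a - b) = Ueval x a - Ueval x b by rewrite !UevalE.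
have eX A x (hx : @qaff_rel K t r s A x) a n :
    Ueval x (a ^+ n) = Ueval x a ^+ n.
  by elim: n => [|n IH]; rewrite ?e1 // !exprS eM ?IH.
have eP A x (hx : @qaff_rel K t r s A x) (F : node t -> Uq) :
    Ueval x (\prod_i F i) = \prod_i Ueval x (F i).
  by apply: big_morph; [exact: eM | exact: e1].
have eG := Ueval_gen.
have eL A x (hx : @qaff_rel K t r s A x) i n a :
    Ueval x (iter n (ad_l Ugen i) a) = iter n (ad_l x i) (Ueval x a).
  by elim: n => //= n IH; rewrite {1}/ad_l eB // !eM // !eG // IH.
have eR A x (hx : @qaff_rel K t r s A x) i n a :
    Ueval x (iter n (ad_r Ugen i) a) = iter n (ad_r x i) (Ueval x a).
  by elim: n => //= n IH; rewrite {1}/ad_r eB // !eM // !eG // IH.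
split=> *; try split; apply: UevalP => A x hx;
  rewrite ?(eB _ _ hx) ?(eL _ _ hx) ?(eR _ _ hx) ?(eX _ _ hx) ?(eP _ _ hx)
    ?(eZ _ _ hx, eM _ _ hx, e1 _ _ hx, e0 _ _ hx, eG _ _ _ hx);
  rewrite ?(eB _ _ hx) ?(eG _ _ _ hx).
all: try by [exact: (rel_inv_w hx _).1 | exact: (rel_inv_w hx _).2
  | exact: (rel_inv_w' hx _).1 | exact: (rel_inv_w' hx _).2
  | exact: (rel_inv_D hx).1 | exact: (rel_inv_D hx).2
  | exact: (rel_inv_D' hx).1 | exact: (rel_inv_D' hx).2
  | exact: (rel_inv_ga hx).1 | exact: (rel_inv_ga hx).2
  | exact: (rel_inv_ga' hx).1 | exact: (rel_inv_ga' hx).2].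
- exact: (rel_central hx).
- rewrite (rel_gamma hx); apply: eq_bigr => i _.
  by rewrite (eX _ _ hx) (eG _ _ _ hx).
- rewrite (rel_gamma' hx); apply: eq_bigr => i _.
  by rewrite (eX _ _ hx) (eG _ _ _ hx).
- exact: (rel_toral hx).
- exact: (rel_De hx).
- exact: (rel_Df hx).
- exact: (rel_we hx).
- exact: (rel_wf hx).
- exact: (rel_De' hx).
- exact: (rel_Df' hx).
- exact: (rel_we' hx).
- exact: (rel_wf' hx).
- exact: (rel_ef hx).
- exact: (rel_serre_e hx).
- exact: (rel_serre_f hx).
Qed.

End PresentedAlgebra.

(* -------------------------------------------------------------------- *)
(* Subalgebras of U.                                                    *)

Section GeneratedSubalgebra.
Variables (K : fieldType) (A : algType K) (X : A -> Prop).

Definition in_subalg (a : A) : Prop :=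
  forall S : {pred A}, subalg_closed S -> (forall x, X x -> x \in S) -> a \in S.

Definition subalg_pred : {pred A} := [pred a | `[< in_subalg a >]].

Lemma subalg_pred_closed : subalg_closed subalg_pred.
Proof.
split=> [|k a b /asboolP ha /asboolP hb|a b /asboolP ha /asboolP hb];
  apply/asboolP => S hS hX; case: (hS) => h1 hL hM //.
- by apply: hL; [exact: ha | exact: hb].
- by apply: hM; [exact: ha | exact: hb].
Qed.

HB.instance Definition _ :=
  GRing.isSubalgClosed.Build K A subalg_pred subalg_pred_closed.

Record subalg := SubAlg { subalg_val : A; _ : subalg_val \in subalg_pred }.

HB.instance Definition _ := [isSub for subalg_val].
HB.instance Definition _ := [Choice of subalg by <:].
HB.instance Definition _ := [SubChoice_isSubAlgebra of subalg by <:].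

End GeneratedSubalgebra.

Section HopfSubalgebras.
Variables (K : fieldType) (t : aff_type) (r s : K).

Definition gens_plus (g : gen t) : bool :=
  match g with ge _ | gw _ | gwV _ => true | _ => false end.

Definition gens_minus (g : gen t) : bool :=
  match g with gf _ | gw' _ | gwV' _ => true | _ => false end.

Definition gens_both (g : gen t) : bool := gens_plus g || gens_minus g.

Definition Usub (P : gen t -> bool) :=
  subalg (fun a : Uq t r s => exists2 g, P g & a = Ugen r s g).

HB.instance Definition _ P := GRing.Algebra.on (Usub P).

(* Bplus and Bminus are closed under the coproduct and the antipode, so they
   are also the Hopf subalgebras generated by these elements.

   Ucore, the subalgebra of U generated by Bplus and Bminus, is the part of U
   that the double can be compared with: U also contains D, D' and the square
   roots gamma^(1/2), gamma'^(1/2), and is not isomorphic to the double, even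
   as an algebra.  Indeed <i,i> <> 1 kills e_i and f_i, hence w_i - w'_i, in
   every commutative quotient, so the largest commutative quotient of the
   double is generated by the #|I_0| units w_i and their inverses, whereas
   that of U has Krull dimension #|I_0| + 2 because of D and D'. *)
Definition Bplus := Usub gens_plus.
Definition Bminus := Usub gens_minus.
Definition Ucore := Usub gens_both.
HB.instance Definition _ := GRing.Algebra.on Bplus.
HB.instance Definition _ := GRing.Algebra.on Bminus.
HB.instance Definition _ := GRing.Algebra.on Ucore.

Local Notation G := (Ugen r s).

(* The Hopf structure in which the w_i, w'_i are group-like and the e_i, f_i
   skew-primitive.  It is stated for all of Bplus, Bminus and Ucore at once;
   the clauses about elements outside Usub P are void. *)
Definition std_hopf (P : gen t -> bool) (H : hopfAlg (Usub P)) : Prop :=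
  forall i : node t,
  [/\ forall e w v : Usub P,
        val e = G (ge i) -> val w = G (gw i) -> val v = G (gwV i) ->
        [/\ cop H e = tensor e 1 + tensor w e, eps H e = 0
          & ant H e = - (v * e)],
      forall f w v : Usub P,
        val f = G (gf i) -> val w = G (gw' i) -> val v = G (gwV' i) ->
        [/\ cop H f = tensor 1 f + tensor f w, eps H f = 0
          & ant H f = - (f * v)]
    & forall w v : Usub P,
        (val w = G (gw i) /\ val v = G (gwV i)) \/
        (val w = G (gw' i) /\ val v = G (gwV' i)) ->
        [/\ cop H w = tensor w w /\ cop H v = tensor v v,
            eps H w = 1 /\ eps H v = 1
          & ant H w = v /\ ant H v = w]].

Definition std_pairing (p : Bminus -> Bplus -> K) : Prop :=
  forall (i j : node t) (f w' v' : Bminus) (e w v : Bplus),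
    val f = G (gf i) -> val w' = G (gw' i) -> val v' = G (gwV' i) ->
    val e = G (ge j) -> val w = G (gw j) -> val v = G (gwV j) ->
    [/\ [/\ p f e = (i == j)%:R / (s - r), p f w = 0 & p f v = 0],
        [/\ p w' e = 0, p w' w = sc t r s i j & p w' v = (sc t r s i j)^-1]
      & [/\ p v' e = 0, p v' w = (sc t r s i j)^-1 & p v' v = sc t r s i j]].

End HopfSubalgebras.

(* Main.v *)
Require Import Defs.
From HB Require Import structures.
From mathcomp Require Import all_boot all_order all_algebra.
From mathcomp Require Import boolp functions ring.

Set Implicit Arguments.
Unset Strict Implicit.
Unset Printing Implicit Defensive.

Import GRing.Theory.
Local Open Scope ring_scope.

(** The two-parameter quantum affine algebra is the double of its halves.

    Write B and B' for the two halves, U_c for the subalgebra of U that they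
    generate, and psi for the linear map from the tensor product of B and B'
    to U_c sending [a (x) f] to [a f].  The theorem says that psi is bijective
    and turns the structure of the double into that of U_c.

    Surjectivity is elementary: [f_i B] lies in [B + B f_i + B w'_i] and
    [w'_i B = B w'_i], so the image of psi is stable under left multiplication
    by every generator of U_c ([f_past], [toral_past], [psi_surj]).

    Injectivity amounts to the triangular decomposition of U_c, and it is
    proved by letting U_c act on the tensor product of B and B' as it would
    act on the double by left multiplication.  An element a of B multiplies
    the left factor ([lam]).  An element f of B' acts by [rho f], which sends [a (x) g]
    to the sum of the [L(S f_(1)) R(f_(3)) a (x) f_(2) g], where L and R
    contract the left and the right tensor factor of the coproduct of a with
    the pairing.  Composed with the antipode, L becomes a representation of B'
    ([antM], [lactM]), R is one ([ractM]), and they commute; since the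
    iterated coproduct is multiplicative, rho is a representation of all of B'
    ([rhoM]).  Hence every relation inside B or inside B', the Serre relations
    included, holds for the operators without computation.  What is left is
    the commutation of the e_j, w_j with the f_i, w'_i.  There f_i acts by
    skew derivations, so the values of the pairing on generators suffice
    ([rho_lam_skew_skew] and its companions).

    The presentation of U also involves D, D' and the square roots of gamma
    and gamma', for which the double offers no candidates.  They are supplied
    once and for all by [core_universal]: in any algebra C, elements
    satisfying the relations among the e_i, f_i, w_i, w'_i, with gamma and
    gamma' central, come from an algebra map on U_c.  Indeed U acts on
    functions from two copies of the integers and two copies of a two-element
    set to C; D and D' shift the integers and the square roots exchange the
    two elements.  The centrality
    of gamma and gamma' in the case at hand comes from the pairing: it shows
    e_i and f_i to be nonzero, so that the centrality of gamma in U forces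
    the products over j of [<i,j>^(m_j)] and [<j,i>^(m_j)] to be 1
    ([prod_row], [prod_col]), and these are the only obstructions.

    Applying the resulting operators to [1 (x) 1] gives a linear map phi on U_c
    with [phi (a f) = a (x) f], the inverse of psi.  The operator of [a f] is
    left multiplication by [a (x) f] in the double ([double_mulE]), which
    makes phi multiplicative.  The coproduct, the counit and the antipode are
    compared on the two halves, where they are determined by the generators
    ([incl_hopf]). *)

(** * The algebra of linear endomorphisms *)

Section Endomorphisms.
Variables (K : fieldType) (V : lmodType K).

Record linop := Linop { linop_fun :> V -> V; linop_linear : linear linop_fun }.

(** A nonzero vector is part of the type, because the algebra must have
    [1 != 0]. *)
Definition endo of exists v : V, v != 0 := linop.

Variable V_neq0 : exists v : V, v != 0.
Local Notation E := (endo V_neq0).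

Lemma endoP (f g : E) : (forall v, f v = g v) -> f = g.
Proof.
case: f g => [f hf] [g hg] /= fg.
have {}fg : f = g by apply/funext.
by case: _ / fg in hg *; congr Linop; apply: Prop_irrelevance.
Qed.

HB.instance Definition _ := gen_eqMixin E.
HB.instance Definition _ := gen_choiceMixin E.

Lemma endoD (f : E) u v : f (u + v) = f u + f v.
Proof. by have := linop_linear f 1 u v; rewrite !scale1r. Qed.

Lemma endo0 (f : E) : f 0 = 0.
Proof. by apply: (addrI (f 0)); rewrite -endoD !addr0. Qed.

Lemma endoZ (f : E) k v : f (k *: v) = k *: f v.
Proof. by have := linop_linear f k v 0; rewrite !addr0 endo0 addr0. Qed.

Fact endo_zero_subproof : linear (fun _ : V => 0 : V).
Proof. by move=> k u v; rewrite scaler0 addr0. Qed.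
Fact endo_opp_subproof (f : E) : linear (fun v => - f v).
Proof. by move=> k u v; rewrite linop_linear opprD scalerN. Qed.
Fact endo_add_subproof (f g : E) : linear (fun v => f v + g v).
Proof. by move=> k u v; rewrite !linop_linear scalerDr addrACA. Qed.
Fact endo_scale_subproof c (f : E) : linear (fun v => c *: f v).
Proof. by move=> k u v; rewrite linop_linear scalerDr !scalerA mulrC. Qed.
Fact endo_one_subproof : linear (fun v : V => v).
Proof. by []. Qed.
Fact endo_mul_subproof (f g : E) : linear (fun v => f (g v)).
Proof. by move=> k u v; rewrite !linop_linear. Qed.

Let zero : E := Linop endo_zero_subproof.
Let opp (f : E) : E := Linop (@endo_opp_subproof f).
Let add (f g : E) : E := Linop (@endo_add_subproof f g).
Let scale c (f : E) : E := Linop (@endo_scale_subproof c f).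
Let one : E := Linop endo_one_subproof.
Let mul (f g : E) : E := Linop (@endo_mul_subproof f g).

Let addA : associative add.
Proof. by move=> f g h; apply: endoP => v /=; rewrite addrA. Qed.
Let addC : commutative add.
Proof. by move=> f g; apply: endoP => v /=; rewrite addrC. Qed.
Let add0 : left_id zero add.
Proof. by move=> f; apply: endoP => v /=; rewrite add0r. Qed.
Let addN : left_inverse zero opp add.
Proof. by move=> f; apply: endoP => v /=; rewrite addNr. Qed.
HB.instance Definition _ := GRing.isZmodule.Build E addA addC add0 addN.

Let mulA : associative mul.
Proof. by move=> f g h; apply: endoP. Qed.
Let mul1l : left_id one mul.
Proof. by move=> f; apply: endoP. Qed.
Let mul1r : right_id one mul.
Proof. by move=> f; apply: endoP. Qed.
Let mulDl : left_distributive mul +%R.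
Proof. by move=> f g h; apply: endoP. Qed.
Let mulDr : right_distributive mul +%R.
Proof. by move=> f g h; apply: endoP => v /=; rewrite endoD. Qed.
Let one_neq0 : one != 0.
Proof.
case: V_neq0 => v /eqP hv; apply/eqP => h; apply: hv.
by rewrite -[LHS]/(one v) h.
Qed.
HB.instance Definition _ := GRing.Zmodule_isNzRing.Build E
  mulA mul1l mul1r mulDl mulDr one_neq0.

Let scaleA a c f : scale a (scale c f) = scale (a * c) f.
Proof. by apply: endoP => v /=; rewrite scalerA. Qed.
Let scale1 : left_id 1 scale.
Proof. by move=> f; apply: endoP => v /=; rewrite scale1r. Qed.
Let scaleDr : right_distributive scale +%R.
Proof. by move=> k f g; apply: endoP => v /=; rewrite scalerDr. Qed.
Let scaleDl f : {morph scale^~ f : a c / a + c}.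
Proof. by move=> a c; apply: endoP => v /=; rewrite scalerDl. Qed.
HB.instance Definition _ := GRing.Zmodule_isLmodule.Build K E
  scaleA scale1 scaleDr scaleDl.

Let scaleAl (k : K) (f g : E) : k *: (f * g) = (k *: f) * g.
Proof. by apply: endoP. Qed.
HB.instance Definition _ := GRing.Lmodule_isLalgebra.Build K E scaleAl.
Let scaleAr (k : K) (f g : E) : k *: (f * g) = f * (k *: g).
Proof. by apply: endoP => v /=; rewrite endoZ. Qed.
HB.instance Definition _ := GRing.Lalgebra_isAlgebra.Build K E scaleAr.

Lemma endoME (f g : E) v : (f * g) v = f (g v). Proof. by []. Qed.
Lemma endoDE (f g : E) v : (f + g) v = f v + g v. Proof. by []. Qed.
Lemma endoNE (f : E) v : (- f) v = - f v. Proof. by []. Qed.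
Lemma endoZE c (f : E) v : (c *: f) v = c *: f v. Proof. by []. Qed.
Lemma endo1E v : (1 : E) v = v. Proof. by []. Qed.
Lemma endo0E v : (0 : E) v = 0. Proof. by []. Qed.
Definition endoE := (endoME, endoDE, endoNE, endoZE, endo1E, endo0E).

End Endomorphisms.

(** * Linear maps on tensor products *)

Definition bilin (K : fieldType) (V W L : lmodType K) (b : V -> W -> L) : Prop :=
  (forall w, linear (b^~ w)) /\ (forall v, linear (b v)).

Definition trilin (K : fieldType) (V W X L : lmodType K) (h : V -> W -> X -> L)
    : Prop :=
  [/\ forall w x, linear (fun v => h v w x), forall v x, linear (fun w => h v w x)
    & forall v w, linear (h v w)].

Section LinearFacts.
Variables (K : fieldType) (V W L : lmodType K).

Lemma bilinP (b : V -> W -> L) : bilin b -> bilinear_for *:%R *:%R b.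
Proof. by case. Qed.

Section One.
Variable f : V -> W.
Hypothesis hf : linear f.
Lemma lin0 : f 0 = 0.
Proof.
by have := hf (-1) 0 0; rewrite scaler0 addr0 scaleN1r addNr.
Qed.
Lemma linD u v : f (u + v) = f u + f v.
Proof. by have := hf 1 u v; rewrite !scale1r. Qed.
Lemma linZ k v : f (k *: v) = k *: f v.
Proof. by have := hf k v 0; rewrite !addr0 lin0 addr0. Qed.
Lemma linN v : f (- v) = - f v.
Proof. by rewrite -scaleN1r linZ scaleN1r. Qed.
Lemma linB u v : f (u - v) = f u - f v.
Proof. by rewrite linD linN. Qed.
Lemma lin_sum I (l : seq I) (F : I -> V) :
  f (\sum_(i <- l) F i) = \sum_(i <- l) f (F i).
Proof. by apply: (big_morph f linD lin0). Qed.
End One.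
End LinearFacts.

Section TensorFacts.
Variables (K : fieldType) (V W : lmodType K).

Lemma tliftE (L : lmodType K) (b : V -> W -> L) (x : tens V W) :
  tlift b x = \sum_(q <- repr x) b q.1 q.2.
Proof. by []. Qed.

Lemma tlift_lin (L : lmodType K) (b : V -> W -> L) : bilin b -> linear (tlift b).
Proof. by move/bilinP/tlift_linear. Qed.

Lemma tlift_tens (L : lmodType K) (b : V -> W -> L) v w :
  bilin b -> tlift b (tensor v w) = b v w.
Proof. by move/bilinP/tlift_tensor. Qed.

Lemma tensor_bilin : bilin (@tensor K V W).
Proof. by have [h1 h2] := @tensor_bilinear K V W; split. Qed.

Lemma tensorLl k (u v : V) (w : W) :
  tensor (k *: u + v) w = k *: tensor u w + tensor v w.
Proof. by have [h _] := tensor_bilin; exact: h. Qed.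

Lemma tensorLr k (v : V) (w x : W) :
  tensor v (k *: w + x) = k *: tensor v w + tensor v x.
Proof. by have [_ h] := tensor_bilin; exact: h. Qed.

Lemma tens_sum (x : tens V W) : x = \sum_(q <- repr x) tensor q.1 q.2.
Proof.
apply: tensP => L b hb.
rewrite (lin_sum (tlift_linear hb)) tliftE.
by apply: eq_bigr => q _; rewrite tlift_tensor.
Qed.

(** How identities on a tensor product are reduced to pure tensors. *)
Lemma tens_linE (L : lmodType K) (f g : tens V W -> L) :
  linear f -> linear g -> (forall v w, f (tensor v w) = g (tensor v w)) ->
  forall x, f x = g x.
Proof.
move=> hf hg fg x; rewrite (tens_sum x) !lin_sum //.
by apply: eq_bigr => q _; rewrite fg.
Qed.

(** [tlift] being a finite sum by definition, b need not be bilinear. *)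
Lemma tlift_comp (L L' : lmodType K) (f : L -> L') (b : V -> W -> L) x :
  linear f -> f (tlift b x) = tlift (fun v w => f (b v w)) x.
Proof. by move=> hf; rewrite !tliftE lin_sum. Qed.

Lemma eq_tlift (L : lmodType K) (b b' : V -> W -> L) x :
  (forall v w, b v w = b' v w) -> tlift b x = tlift b' x.
Proof. by move=> h; rewrite !tliftE; apply: eq_bigr => q _. Qed.

End TensorFacts.

Section TensorMapFacts.
Variables (K : fieldType) (V W : lmodType K).

Lemma tlift_tmap (V' W' L : lmodType K) (f : V -> V') (g : W -> W')
    (b : V' -> W' -> L) x :
  bilin b -> tlift b (tmap f g x) = tlift (fun v w => b (f v) (g w)) x.
Proof.
move=> hb; rewrite /tmap (tlift_comp _ _ (tlift_lin hb)).
by apply: eq_tlift => v w; rewrite tlift_tens.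
Qed.

Lemma tmap_lin (V' W' : lmodType K) (f : V -> V') (g : W -> W') :
  linear f -> linear g -> linear (tmap f g).
Proof.
move=> hf hg; apply: tlift_lin; split=> [w k u v|v k u w].
  by rewrite hf tensorLl.
by rewrite hg tensorLr.
Qed.

Lemma tmap_tens (V' W' : lmodType K) (f : V -> V') (g : W -> W') v w :
  linear f -> linear g -> tmap f g (tensor v w) = tensor (f v) (g w).
Proof.
move=> hf hg; rewrite /tmap tlift_tens //; split=> [x k u u'|u k x x'].
  by rewrite hf tensorLl.
by rewrite hg tensorLr.
Qed.
End TensorMapFacts.

(* Splits a linear combination of finite sums into summands, once or through
   all nested sums. *)
Ltac linsum1 := rewrite scaler_sumr -big_split /=; apply: eq_bigr => ? _.
Ltac linsum := repeat linsum1.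

(** * Sweedler calculus in a Hopf algebra *)

Section HopfFacts.
Variables (K : fieldType) (A : algType K) (H : hopfAlg A).
Local Notation cop := (cop H).
Local Notation eps := (eps H).
Local Notation S := (ant H).

Lemma cop_lin : linear cop. Proof. by case: H. Qed.
Lemma eps_lin : scalar eps. Proof. by case: H. Qed.
Lemma ant_lin : linear S. Proof. by case: H. Qed.
Lemma cop1 : cop 1 = tensor 1 1. Proof. by case: H. Qed.
Lemma copM x y : cop (x * y) = tmul (cop x) (cop y). Proof. by case: H. Qed.
Lemma eps1 : eps 1 = 1. Proof. by case: H. Qed.
Lemma epsM x y : eps (x * y) = eps x * eps y. Proof. by case: H. Qed.

Lemma cop_tlift_lin (L : lmodType K) (b : A -> A -> L) :
  bilin b -> linear (fun x => tlift b (cop x)).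
Proof. by move=> hb k u v; rewrite cop_lin (tlift_lin hb). Qed.

(** Coassociativity in the form in which it is used: a trilinear function
    takes the same value on the two iterated coproducts. *)
Lemma sum_coassoc (L : lmodType K) (h : A -> A -> A -> L) x : trilin h ->
  tlift (fun u c => tlift (fun a b => h a b c) (cop u)) (cop x) =
  tlift (fun a u => tlift (fun b c => h a b c) (cop u)) (cop x).
Proof.
move=> [h1 h2 h3].
have hab c : bilin (fun a b => h a b c).
  by split=> *; [exact: h1 | exact: h2].
have hbc a : bilin (h a) by split=> *; [exact: h2 | exact: h3].
have hL : bilin (fun a => tlift (h a)).
  split=> [u k v v'|v]; last exact: tlift_lin.
  by rewrite !tliftE; linsum; rewrite h1.
have hR : bilin (fun u c => tlift (fun a b => h a b c) u).
  split=> [c|u k c c']; first exact: tlift_lin.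
  by rewrite !tliftE; linsum; rewrite h3.
have : tassoc (tmap cop id (cop x)) = tmap id cop (cop x) by case: H.
move/(congr1 (tlift (fun a => tlift (h a)))).
rewrite tlift_tmap // => <-; rewrite /tassoc (tlift_comp _ _ (tlift_lin hL)).
rewrite -(tlift_tmap _ id _ hR); apply: eq_tlift => u c.
rewrite (tlift_comp _ _ (tlift_lin hL)); apply: eq_tlift => a b.
by rewrite tlift_tens // tlift_tens.
Qed.

Lemma sum_counitl (L : lmodType K) (h : A -> L) x : linear h ->
  tlift (fun a b => eps a *: h b) (cop x) = h x.
Proof.
move=> hh; have e : tlift (fun a b => eps a *: b) (cop x) = x by case: H.
rewrite -[in RHS]e (tlift_comp _ _ hh); apply: eq_tlift => a b.
by rewrite linZ.
Qed.

Lemma sum_counitr (L : lmodType K) (h : A -> L) x : linear h ->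
  tlift (fun a b => eps b *: h a) (cop x) = h x.
Proof.
move=> hh; have e : tlift (fun a b => eps b *: a) (cop x) = x by case: H.
rewrite -[in RHS]e (tlift_comp _ _ hh); apply: eq_tlift => a b.
by rewrite linZ.
Qed.

Lemma antl x : tlift (fun a b => S a * b) (cop x) = (eps x)%:A.
Proof. by case: H. Qed.
Lemma antr x : tlift (fun a b => a * S b) (cop x) = (eps x)%:A.
Proof. by case: H. Qed.

Lemma tlift_copM (L : lmodType K) (b : A -> A -> L) x y : bilin b ->
  tlift b (cop (x * y)) =
  tlift (fun x1 x2 => tlift (fun y1 y2 => b (x1 * y1) (x2 * y2)) (cop y)) (cop x).
Proof.
move=> hb; rewrite copM /tmul (tlift_comp _ _ (tlift_lin hb)).
apply: eq_tlift => x1 x2; rewrite (tlift_comp _ _ (tlift_lin hb)).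
by apply: eq_tlift => y1 y2; rewrite tlift_tens.
Qed.

(** Both [S (x * y)] and [S y * S x] are convolution inverses of the
    multiplication on the coalgebra [A (x) A], the first on the left and the
    second on the right. *)
Lemma antM x y : S (x * y) = S y * S x.
Proof.
have mL k (u v a : A) : (k *: u + v) * a = k *: (u * a) + v * a.
  by rewrite mulrDl scalerAl.
have mR k (u v a : A) : a * (k *: u + v) = k *: (a * u) + a * v.
  by rewrite mulrDr scalerAr.
have linE := (mL, mR, ant_lin).
(* S (x * y) is a left convolution inverse of the product, ... *)
have convl u v : tlift (fun u1 u2 => tlift (fun v1 v2 =>
    S (u1 * v1) * (u2 * v2)) (cop v)) (cop u) = (eps u * eps v)%:A.
  rewrite -epsM -antl tlift_copM //.
  by split=> ? k a b /=; rewrite !linE.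
(* ... and S y * S x is a right one. *)
have convr u v : tlift (fun u1 u2 => tlift (fun v1 v2 =>
    (u1 * v1) * (S v2 * S u2)) (cop v)) (cop u) = (eps u * eps v)%:A.
  transitivity (eps v *: tlift (fun a b => a * S b) (cop u)); last first.
    by rewrite antr scalerA mulrC.
  rewrite !tliftE scaler_sumr; apply: eq_bigr => q _.
  transitivity (q.1 * (tlift (fun a b => a * S b) (cop v)) * S q.2).
    by rewrite tliftE mulr_sumr mulr_suml; apply: eq_bigr => q' _; rewrite !mulrA.
  by rewrite antr -scalerAr mulr1 scalerAl.
transitivity (tlift (fun x1 x2 => tlift (fun y1 y2 =>
   (eps x2 * eps y2) *: S (x1 * y1)) (cop y)) (cop x)).
  rewrite -(@sum_counitr _ (fun x => S (x * y)) x); last first.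
    by move=> k a b /=; rewrite !linE.
  apply: eq_tlift => x1 x2.
  rewrite -(@sum_counitr _ (fun y => S (x1 * y)) y); last first.
    by move=> k a b /=; rewrite !linE.
  rewrite !tliftE scaler_sumr; apply: eq_bigr => q _.
  by rewrite scalerA.
transitivity (tlift (fun x1 x2 => tlift (fun x21 x22 =>
    tlift (fun y1 y2 => tlift (fun y21 y22 =>
      S (x1 * y1) * (x21 * y21 * (S y22 * S x22))) (cop y2)) (cop y))
    (cop x2)) (cop x)).
  apply: eq_tlift => x1 x2; rewrite !tliftE.
  under [RHS]eq_bigr do rewrite tliftE.
  rewrite exchange_big; apply: eq_bigr => q _.
  transitivity (S (x1 * q.1) * (eps x2 * eps q.2)%:A).
    by rewrite -scalerAr mulr1.
  rewrite -convr !tliftE mulr_sumr; apply: eq_bigr => q' _.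
  by rewrite tliftE mulr_sumr.
rewrite -(@sum_coassoc _ (fun a b c => tlift (fun y1 y2 => tlift (fun y21 y22 =>
     S (a * y1) * (b * y21 * (S y22 * S c))) (cop y2)) (cop y))); last first.
  by split=> ? ? k a b /=; rewrite !tliftE; linsum; rewrite !linE.
rewrite -(@sum_counitl _ (fun x => S y * S x)); last by move=> k a b /=; rewrite !linE.
apply: eq_tlift => x1 x2.
transitivity (tlift (fun x11 x12 => tlift (fun y1 y2 => tlift (fun y11 y12 =>
   S (x11 * y11) * (x12 * y12 * (S y2 * S x2))) (cop y1)) (cop y)) (cop x1)).
  apply: eq_tlift => x11 x12; rewrite -(@sum_coassoc _ (fun a b c =>
     S (x11 * a) * (x12 * b * (S c * S x2)))) //.
  by split=> ? ? k a b /=; rewrite !linE.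
rewrite -(@sum_counitl _ (fun y => S y * S x2) y); last first.
  by move=> k a b /=; rewrite !linE.
rewrite !tliftE; under eq_bigr do rewrite tliftE.
rewrite exchange_big scaler_sumr; apply: eq_bigr => q _.
transitivity ((eps x1 * eps q.1)%:A * (S q.2 * S x2)); last first.
  by rewrite -scalerAl mul1r scalerA.
rewrite -convl !tliftE mulr_suml; apply: eq_bigr => q' _.
by rewrite tliftE mulr_suml; apply: eq_bigr => q'' _; rewrite !mulrA.
Qed.

Lemma ant1 : S 1 = 1.
Proof.
have := antl 1; rewrite cop1 eps1 scale1r tlift_tens ?mulr1 //.
by split=> ? k a b /=; rewrite ?ant_lin ?mulrDl ?mulrDr -?scalerAl -?scalerAr.
Qed.

Lemma eps_ant x : eps (S x) = eps x.
Proof.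
have el : linear (eps : A -> K^o) := eps_lin.
have e := @sum_counitr (K^o : lmodType K) (fun a => eps (S a)) x.
rewrite -[LHS]e; last by move=> k a b; rewrite ant_lin eps_lin.
transitivity (eps (tlift (fun a b => S a * b) (cop x)) : K^o); last first.
  by rewrite antl (linZ el) eps1; exact: mulr1.
rewrite -[RHS]/((eps : A -> K^o) _) (tlift_comp _ _ el) !tliftE.
by apply: eq_bigr => q _; rewrite /= epsM mulrC.
Qed.

Lemma tlift3_cop2 (L : lmodType K) (h : A -> A -> A -> L) x : trilin h ->
  tlift3 h (cop2 H x) =
  tlift (fun u c => tlift (fun a b => h a b c) (cop u)) (cop x).
Proof.
move=> [h1 h2 h3]; rewrite /tlift3 /cop2 tlift_tmap //.
split=> [c|u k c c'].
  by apply: tlift_lin; split=> *; [exact: h1 | exact: h2].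
by rewrite !tliftE; linsum; rewrite h3.
Qed.
End HopfFacts.

Lemma eq_tlift3 (K : fieldType) (V W X L : lmodType K) (h h' : V -> W -> X -> L) x :
  (forall a b c, h a b c = h' a b c) -> tlift3 h x = tlift3 h' x.
Proof. by move=> hh; apply: eq_tlift => u c; apply: eq_tlift. Qed.

(** * Adjoint actions and generated subalgebras *)

Section AdIter.
Variables (K : fieldType) (t : aff_type).

(** Used to carry the Serre relations from U to its halves and from there to
    operators; x and y need only correspond on the three generators that the
    adjoint action of e_i involves. *)
Lemma ad_l_iter_morph (A B : algType K) (x : gen t -> A) (y : gen t -> B)
    (h : A -> B) (i : node t) n a :
  (forall u v, h (u - v) = h u - h v) -> (forall u v, h (u * v) = h u * h v) ->
  h (x (ge i)) = y (ge i) -> h (x (gw i)) = y (gw i) ->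
  h (x (gwV i)) = y (gwV i) ->
  h (iter n (ad_l x i) a) = iter n (ad_l y i) (h a).
Proof.
move=> hB hM he hw hv; elim: n => //= n <-.
by rewrite /ad_l hB !hM he hw hv.
Qed.

Lemma ad_r_iter_morph (A B : algType K) (x : gen t -> A) (y : gen t -> B)
    (h : A -> B) (i : node t) n a :
  (forall u v, h (u - v) = h u - h v) -> (forall u v, h (u * v) = h u * h v) ->
  h (x (gf i)) = y (gf i) -> h (x (gw' i)) = y (gw' i) ->
  h (x (gwV' i)) = y (gwV' i) ->
  h (iter n (ad_r x i) a) = iter n (ad_r y i) (h a).
Proof.
move=> hB hM he hw hv; elim: n => //= n <-.
by rewrite /ad_r hB !hM he hw hv.
Qed.
End AdIter.

Section SubalgebraInduction.
Variables (K : fieldType) (t : aff_type) (r s : K) (P : gen t -> bool).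

Lemma Usub_valL k (a b : Usub r s P) : val (k *: a + b) = k *: val a + val b.
Proof. by []. Qed.
Lemma Usub_valM (a b : Usub r s P) : val (a * b) = val a * val b.
Proof. by []. Qed.
Lemma Usub_val1 : val (1 : Usub r s P) = 1.
Proof. by []. Qed.

Lemma Usub_ind (Q : Usub r s P -> Prop) :
  Q 1 -> (forall k a b, Q a -> Q b -> Q (k *: a + b)) ->
  (forall a b, Q a -> Q b -> Q (a * b)) ->
  (forall g a, P g -> val a = Ugen r s g -> Q a) -> forall a, Q a.
Proof.
move=> Q1 QL QM QG [u hu]; have /asboolP hin := hu.
pose S := [pred v | `[< exists2 a : Usub r s P, val a = v & Q a >]].
have S_closed : subalg_closed S.
  split=> [|k _ _ /asboolP[a <- Qa] /asboolP[b <- Qb]|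
           _ _ /asboolP[a <- Qa] /asboolP[b <- Qb]]; apply/asboolP.
  - by exists 1.
  - by exists (k *: a + b); first rewrite Usub_valL; last exact: QL.
  - by exists (a * b); first rewrite Usub_valM; last exact: QM.
have gen_S v : (exists2 g, P g & v = Ugen r s g) -> v \in S.
  move=> hv; apply/asboolP; have hv' : v \in
    subalg_pred (fun a : Uq t r s => exists2 g, P g & a = Ugen r s g).
    by apply/asboolP => S' _ h; exact: h.
  by exists (SubAlg hv'); last by case: (hv) => g Pg vE; exact: (QG g).
have /asboolP[a ha Qa] := hin S S_closed gen_S.
by have <- : a = SubAlg hu by apply: val_inj.
Qed.
End SubalgebraInduction.

(** * A presentation of the core subalgebra *)

Section CoreRelations.
Variables (K : fieldType) (t : aff_type) (r s : K).
Variables (C : algType K) (y : gen t -> C).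

(** The relations of U among the e_i, f_i, w_i, w'_i.  Of gamma^(1/2) and
    gamma'^(1/2) there remains the centrality of their squares. *)
Record core_rel : Prop := CoreRel {
  core_inv_w : forall i, y (gw i) * y (gwV i) = 1 /\ y (gwV i) * y (gw i) = 1;
  core_inv_w' : forall i,
    y (gw' i) * y (gwV' i) = 1 /\ y (gwV' i) * y (gw' i) = 1;
  core_toral : forall g h, gens_both g -> gens_both h -> toral g -> toral h ->
    y g * y h = y h * y g;
  core_central : forall g, gens_both g ->
    (\prod_(i : node t) y (gwV i) ^+ mark t i) * y g
      = y g * \prod_(i : node t) y (gwV i) ^+ mark t i;
  core_central' : forall g, gens_both g ->
    (\prod_(i : node t) y (gwV' i) ^+ mark t i) * y g
      = y g * \prod_(i : node t) y (gwV' i) ^+ mark t i;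
  core_we : forall i j : node t,
    y (gw j) * y (ge i) * y (gwV j) = sc t r s i j *: y (ge i);
  core_wf : forall i j : node t,
    y (gw j) * y (gf i) * y (gwV j) = (sc t r s i j)^-1 *: y (gf i);
  core_we' : forall i j : node t,
    y (gw' j) * y (ge i) * y (gwV' j) = (sc t r s j i)^-1 *: y (ge i);
  core_wf' : forall i j : node t,
    y (gw' j) * y (gf i) * y (gwV' j) = sc t r s j i *: y (gf i);
  core_ef : forall i j : node t,
    y (ge i) * y (gf j) - y (gf j) * y (ge i) =
      ((i == j)%:R / (r - s)) *: (y (gw i) - y (gw' i));
  core_serre_e : forall i j : node t, i != j ->
    iter (absz (1 - cartan t i j)) (ad_l y i) (y (ge j)) = 0;
  core_serre_f : forall i j : node t, i != j ->
    iter (absz (1 - cartan t i j)) (ad_r y i) (y (gf j)) = 0 }.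

End CoreRelations.

Section InverseProducts.
Variables (K : fieldType) (C : algType K) (I : finType) (u v : I -> C).
Hypotheses (uv : forall i, u i * v i = 1).
Hypothesis (cu : forall i j, u i * u j = u j * u i).

Lemma prod_pow_inv (m : I -> nat) :
  (forall i j, u i * v j = v j * u i) ->
  (\prod_i u i ^+ m i) * (\prod_i v i ^+ m i) = 1.
Proof.
move=> cuv; have cX i (x : C) : GRing.comm (v i) x -> GRing.comm (v i ^+ m i) x.
  by move=> h; apply/commr_sym/commrX/commr_sym.
elim: index_enum => [|i l IH]; first by rewrite !big_nil mulr1.
rewrite !big_cons -mulrA [X in _ * X]mulrA.
have -> : (\prod_(j <- l) u j ^+ m j) * v i ^+ m i =
          v i ^+ m i * \prod_(j <- l) u j ^+ m j.
  apply/esym/commr_prod => j _; apply: commrX.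
  by apply/commr_sym/commrX; exact: cuv.
rewrite -mulrA IH mulr1 -exprMn_comm ?uv ?expr1n //; exact: cuv.
Qed.
End InverseProducts.

(** With x = e_i and v the inverses of the w_j, this measures how far gamma'
    is from commuting with e_i. *)
Lemma prod_skew_comm (K : fieldType) (C : algType K) (I : finType)
    (v : I -> C) (c : I -> K) (x : C) (m : I -> nat) :
  (forall i, v i * x = c i *: (x * v i)) ->
  (\prod_i v i ^+ m i) * x = (\prod_i c i ^+ m i) *: (x * \prod_i v i ^+ m i).
Proof.
move=> vx; elim: index_enum => [|i l IH].
  by rewrite !big_nil mul1r mulr1 scale1r.
have vX n : v i ^+ n * x = c i ^+ n *: (x * v i ^+ n).
  elim: n => [|n IHn]; first by rewrite !expr0 mul1r mulr1 scale1r.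
  rewrite exprS -mulrA IHn -scalerAr [v i * (x * _)]mulrA vx -scalerAl scalerA.
  by rewrite exprS -!mulrA [c i ^+ n * _]mulrC.
rewrite !big_cons -mulrA IH -scalerAr [_ ^+ _ * (x * _)]mulrA vX.
by rewrite -scalerAl scalerA -!mulrA mulrC.
Qed.

Lemma prod_expV_eq1 (K : fieldType) (I : finType) (c : I -> K) (m : I -> nat) :
  \prod_j (c j)^-1 ^+ m j = 1 -> \prod_j c j ^+ m j = 1.
Proof.
move=> h; rewrite -[LHS]invrK -prodfV; under eq_bigr do rewrite -exprVn.
by rewrite h invr1.
Qed.

Section SkewCommutation.
Variables (K : fieldType) (C : algType K).

Lemma skew_comm_inv (a b b' : C) k : k != 0 -> b * b' = 1 -> b' * b = 1 ->
  b * a = k *: (a * b) -> b' * a = k^-1 *: (a * b').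
Proof.
move=> k0 h1 h2 h.
have -> : a * b' = b' * (b * a) * b' by rewrite mulrA h2 mul1r.
by rewrite h -scalerAr -scalerAl scalerA mulVf // scale1r -!mulrA h1 mulr1.
Qed.

Lemma skew_comm_conj (a b b' : C) k : b * b' = 1 ->
  b * a = k *: (a * b) -> b * a * b' = k *: a.
Proof. by move=> h1 ->; rewrite -scalerAl -mulrA h1 mulr1. Qed.

Lemma conj_skew_comm (a b b' : C) k : b' * b = 1 ->
  b * a * b' = k *: a -> b * a = k *: (a * b).
Proof. by move=> h h1; rewrite scalerAl -h1 -[RHS]mulrA h mulr1. Qed.
End SkewCommutation.

Section Universal.
Variables (K : fieldType) (t : aff_type) (r s : K).
Hypotheses (r_neq0 : r != 0) (s_neq0 : s != 0).
Variables (C : algType K) (y : gen t -> C).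
Hypothesis hy : core_rel r s y.

Let idx : Type := ((int * int) * (bool * bool))%type.
Let V : lmodType K := (idx -> C : lmodType K).

Let V_neq0 : exists X : V, X != 0.
Proof.
exists (fun=> 1); apply/eqP => /(congr1 (fun X : V => X (0, 0, (false, false)))).
by move/eqP; rewrite oner_eq0.
Qed.

Local Notation E := (endo V_neq0).

Fact wshift_subproof (sg : idx -> idx) (w : idx -> C) :
  linear (fun X : V => (fun k => w k * X (sg k)) : V).
Proof.
move=> c X X'; apply/funext => k.
by rewrite -[LHS]/(w k * (c *: X (sg k) + X' (sg k))) mulrDr -scalerAr.
Qed.
(** All generators of U will act by weighted shifts of this kind. *)
Definition wshift sg w : E := Linop (wshift_subproof sg w).

(* Shifting k by one in the first (second) integer must multiply the weight of
   e_0 by r (by s): these are the relations of D and D' with e_0. *)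
Let chi (k : idx) : K := r ^ k.1.1 * s ^ k.1.2.
Let zV' := \prod_(i : node t) y (gwV' i) ^+ mark t i.
Let z' := \prod_(i : node t) y (gw' i) ^+ mark t i.
Let zV := \prod_(i : node t) y (gwV i) ^+ mark t i.
Let z := \prod_(i : node t) y (gw i) ^+ mark t i.

Let sh (a b : int) (k : idx) : idx := ((k.1.1 + a, k.1.2 + b), k.2).
(* Exchanging two copies of C, with weight z on one copy and 1 on the other,
   gives a square root of multiplication by z. *)
Let flip (k : idx) : idx := (k.1, (~~ k.2.1, k.2.2)).
Let flip' (k : idx) : idx := (k.1, (k.2.1, ~~ k.2.2)).

Definition ext_gen (g : gen t) : E :=
  match g with
  | ge i => wshift id (fun k => chi k ^+ (i == ord0) *: y (ge i))
  | gf i => wshift id (fun k => chi k ^- (i == ord0) *: y (gf i))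
  | ga => wshift flip (fun k => if k.2.1 then zV' else 1)
  | gaV => wshift flip (fun k => if k.2.1 then 1 else z')
  | ga' => wshift flip' (fun k => if k.2.2 then zV else 1)
  | gaV' => wshift flip' (fun k => if k.2.2 then 1 else z)
  | gD => wshift (sh 1 0) (fun=> 1)
  | gDV => wshift (sh (- 1) 0) (fun=> 1)
  | gD' => wshift (sh 0 1) (fun=> 1)
  | gDV' => wshift (sh 0 (- 1)) (fun=> 1)
  | g => wshift id (fun=> y g)
  end.

Let wshiftE sg w X k : wshift sg w X k = w k * X (sg k). Proof. by []. Qed.

Let wshiftP (f g : E) : (forall X k, f X k = g X k) -> f = g.
Proof. by move=> h; apply: endoP => X; apply/funext => k; exact: h. Qed.

Let chi_neq0 k : chi k != 0.
Proof. by rewrite mulf_neq0 // expfz_neq0. Qed.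

Let wz (f g : E) X k : (f * g) X k = f (g X) k. Proof. by []. Qed.
Let wd (f g : E) X k : (f + g) X k = f X k + g X k. Proof. by []. Qed.
Let wn (f : E) X k : (- f) X k = - f X k. Proof. by []. Qed.
Let ws c (f : E) X k : (c *: f) X k = c *: f X k. Proof. by []. Qed.
Let w1 X k : (1 : E) X k = X k. Proof. by []. Qed.
Let wE := (wz, wd, wn, ws, w1, wshiftE).

Let zzV : z * zV = 1.
Proof.
apply: prod_pow_inv => i *; first exact: (core_inv_w hy i).1.
all: exact: core_toral hy _ _ _ _ _ _.
Qed.
Let zVz : zV * z = 1.
Proof.
apply: prod_pow_inv => i *; first exact: (core_inv_w hy i).2.
all: exact: core_toral hy _ _ _ _ _ _.
Qed.
Let zzV' : z' * zV' = 1.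
Proof.
apply: prod_pow_inv => i *; first exact: (core_inv_w' hy i).1.
all: exact: core_toral hy _ _ _ _ _ _.
Qed.
Let zVz' : zV' * z' = 1.
Proof.
apply: prod_pow_inv => i *; first exact: (core_inv_w' hy i).2.
all: exact: core_toral hy _ _ _ _ _ _.
Qed.

Let zV_c g : gens_both g -> zV * y g = y g * zV.
Proof. exact: (core_central hy). Qed.
Let zV_c' g : gens_both g -> zV' * y g = y g * zV'.
Proof. exact: (core_central' hy). Qed.
Let z_c g : gens_both g -> z * y g = y g * z.
Proof.
move=> hg; rewrite -[LHS]mulr1 -zVz !mulrA -[z * y g * zV]mulrA -zV_c //.
by rewrite !mulrA zzV mul1r.
Qed.
Let z_c' g : gens_both g -> z' * y g = y g * z'.
Proof.
move=> hg; rewrite -[LHS]mulr1 -zVz' !mulrA -[z' * y g * zV']mulrA -zV_c' //.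
by rewrite !mulrA zzV' mul1r.
Qed.

Let comm_prod (a : C) (F : node t -> C) :
  (forall i, a * F i = F i * a) ->
  a * (\prod_i F i ^+ mark t i) = (\prod_i F i ^+ mark t i) * a.
Proof. by move=> h; apply: commr_prod => i _; apply: commrX; exact: h. Qed.

Lemma ext_gen_iter_l (i : node t) n (c : idx -> K) (b : C) :
  iter n (ad_l ext_gen i) (wshift id (fun k => c k *: b)) =
  wshift id (fun k => ((chi k ^+ (i == ord0)) ^+ n * c k) *: iter n (ad_l y i) b).
Proof.
elim: n => [|n IH] /=; first by apply: wshiftP => X k; rewrite !wE mul1r.
rewrite IH /ad_l; apply: wshiftP => X k; rewrite !wE /= !mulrA -mulrBl.
congr (_ * X k); rewrite -?scalerAl -?scalerAr -?scalerAl -?scalerAr -?scalerAl.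
by rewrite -!scalerBr scalerA exprS -!mulrA.
Qed.

Lemma ext_gen_iter_r (i : node t) n (c : idx -> K) (b : C) :
  iter n (ad_r ext_gen i) (wshift id (fun k => c k *: b)) =
  wshift id (fun k => ((chi k ^- (i == ord0)) ^+ n * c k) *: iter n (ad_r y i) b).
Proof.
elim: n => [|n IH] /=; first by apply: wshiftP => X k; rewrite !wE mul1r.
rewrite IH /ad_r; apply: wshiftP => X k; rewrite !wE /= !mulrA -mulrBl.
congr (_ * X k); rewrite -?scalerAl -?scalerAr -?scalerAl -?scalerAr -?scalerAl.
set a := chi k ^- _; set d := a ^+ n * c k.
have -> : a ^+ n.+1 * c k = a * d by rewrite exprS mulrA.
by rewrite !scalerA [d * a]mulrC -scalerBr.
Qed.

Lemma prod_wshift (F : node t -> C) (m : node t -> nat) :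
  \prod_(i : node t) wshift id (fun=> F i) ^+ m i =
  wshift id (fun=> \prod_(i : node t) F i ^+ m i).
Proof.
have wshiftM a b : wshift id (fun=> a) * wshift id (fun=> b) =
    wshift id (fun=> a * b) :> E.
  by apply: wshiftP => X k; rewrite !wE mulrA.
have wshift1 : wshift id (fun=> 1) = 1 :> E.
  by apply: wshiftP => X k; rewrite !wE mul1r.
rewrite [RHS](big_morph (fun a => wshift id (fun=> a)) (id1 := 1) (op1 := *%R));
  [|by move=> a b; rewrite wshiftM|exact: wshift1].
apply: eq_bigr => i _; elim: (m i) => [|n IH]; first by rewrite !expr0 wshift1.
by rewrite !exprS IH wshiftM.
Qed.

Lemma ext_gen_rel : qaff_rel r s ext_gen.
Proof.
have shK a b k : sh (- a) (- b) (sh a b k) = k.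
  by case: k => [[a' b'] c]; rewrite /sh /= !addrK.
have shKV a b k : sh a b (sh (- a) (- b) k) = k.
  by case: k => [[a' b'] c]; rewrite /sh /= !subrK.
have chiD k : (chi (sh 1 0 k) = r * chi k) * (chi (sh 0 1 k) = s * chi k).
  case: k => [[a b] c]; rewrite /chi /sh /= !addr0 !expfzDr //.
  by split; rewrite ?expr1z; ring.
have [shK10 shV10] : (forall k, sh (-1) 0 (sh 1 0 k) = k) /\
    (forall k, sh 1 0 (sh (-1) 0 k) = k).
  by split=> k; [exact: (shK 1 0) | exact: (shKV 1 0)].
have [shK01 shV01] : (forall k, sh 0 (-1) (sh 0 1 k) = k) /\
    (forall k, sh 0 1 (sh 0 (-1) k) = k).
  by split=> k; [exact: (shK 0 1) | exact: (shKV 0 1)].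
split.
- by move=> i; split; apply: wshiftP => X k; rewrite !wE /= mulrA
    ?(core_inv_w hy i).1 ?(core_inv_w hy i).2 mul1r.
- by move=> i; split; apply: wshiftP => X k; rewrite !wE /= mulrA
    ?(core_inv_w' hy i).1 ?(core_inv_w' hy i).2 mul1r.
- by split; apply: wshiftP => X k; rewrite !wE !mul1r ?shK10 ?shV10.
- by split; apply: wshiftP => X k; rewrite !wE !mul1r ?shK01 ?shV01.
- by split; apply: wshiftP => X [k [[] b]]; rewrite !wE /= mulrA ?mul1r
    ?zVz' ?zzV' ?mul1r.
- by split; apply: wshiftP => X [k [b []]]; rewrite !wE /= mulrA ?mul1r
    ?zVz ?zzV ?mul1r.
- have hz := (zV_c, zV_c', z_c, z_c').
  have czz : zV * zV' = zV' * zV.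
    by apply: comm_prod => i; rewrite hz.
  have czz1 : zV * z' = z' * zV.
    by apply: comm_prod => i; rewrite hz.
  have czz2 : z * zV' = zV' * z.
    by apply: comm_prod => i; rewrite hz.
  have czz3 : z * z' = z' * z.
    by apply: comm_prod => i; rewrite hz.
  case=> //= h _; apply: wshiftP => X [k [b b']];
    case: h => [i|i|i|i|i|i||||||||]; rewrite !wE /= !mulrA ?mul1r;
    case: b; case: b' => /=;
    rewrite -?scalerAr -?scalerAl ?mulr1 ?mul1r ?hz ?zVz ?zzV ?zVz' ?zzV'
      ?czz ?czz1 ?czz2 ?czz3 ?mul1r ?mulr1 //.
- rewrite prod_wshift; apply: wshiftP => X [k [b b']]; rewrite !wE mulrA.
  by case: b; rewrite /= ?mul1r ?mulr1.
- rewrite prod_wshift; apply: wshiftP => X [k [b b']]; rewrite !wE mulrA.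
  by case: b'; rewrite /= ?mul1r ?mulr1.
- have shC a b a' b' k : sh a b (sh a' b' k) = sh a' b' (sh a b k).
    by rewrite /sh /= ![_ + a' + _]addrAC ![_ + b' + _]addrAC.
  case=> //= [i|i|i|i||||] [] //=; first [move=> j _ _ | move=> _ _];
    apply: wshiftP => X k; rewrite !wE /= ?mulrA ?mul1r ?mulr1 //;
    by [congr (_ * X k); apply: (core_toral hy) | congr (X _); apply: shC].
- move=> i; apply: wshiftP => X k; rewrite !wE !mul1r shK10 (chiD k).1.
  by rewrite -!scalerAl scalerA; case: (i == ord0); rewrite ?mul1r.
- move=> i; apply: wshiftP => X k; rewrite !wE !mul1r shK10 (chiD k).1.
  by rewrite -!scalerAl scalerA; case: (i == ord0); rewrite ?invr1 ?mul1r // invfM.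
- move=> i j; apply: wshiftP => X k; rewrite !wE /= !mulrA -!scalerAr -!scalerAl.
  by rewrite (core_we hy) -!scalerAl !scalerA mulrC.
- move=> i j; apply: wshiftP => X k; rewrite !wE /= !mulrA -!scalerAr -!scalerAl.
  by rewrite (core_wf hy) -!scalerAl !scalerA mulrC.
- move=> i; apply: wshiftP => X k; rewrite !wE !mul1r shK01 (chiD k).2.
  by rewrite -!scalerAl scalerA; case: (i == ord0); rewrite ?mul1r.
- move=> i; apply: wshiftP => X k; rewrite !wE !mul1r shK01 (chiD k).2.
  by rewrite -!scalerAl scalerA; case: (i == ord0); rewrite ?invr1 ?mul1r // invfM.
- move=> i j; apply: wshiftP => X k; rewrite !wE /= !mulrA -!scalerAr -!scalerAl.
  by rewrite (core_we' hy) -!scalerAl !scalerA mulrC.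
- move=> i j; apply: wshiftP => X k; rewrite !wE /= !mulrA -!scalerAr -!scalerAl.
  by rewrite (core_wf' hy) -!scalerAl !scalerA mulrC.
- move=> i j; apply: wshiftP => X k; rewrite !wE /= !mulrA -!mulrBl scalerAl.
  rewrite -(core_ef hy); congr (_ * X k).
  rewrite -!scalerAr -!scalerAl ![chi k ^+ _ *: (_ *: _)]scalerA scalerA.
  rewrite [chi k ^- _ * _]mulrC -scalerBr (core_ef hy) scalerA; congr (_ *: _).
  by have [->|_] := eqVneq i j; rewrite ?mul0r ?mulr0 // mulfV ?mul1r ?expf_neq0.
- move=> i j ij. rewrite (ext_gen_iter_l i _ _ (y (ge j))) (core_serre_e hy) //.
  by apply: wshiftP => X k; rewrite !wE scaler0 mul0r.
- move=> i j ij; rewrite (ext_gen_iter_r i _ _ (y (gf j))) (core_serre_f hy) //.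
  by apply: wshiftP => X k; rewrite !wE scaler0 mul0r.
Qed.

(** The subalgebra of U generated by the e_i, f_i, w_i, w'_i is presented by
    the core relations: U acts on functions with values in C, its core acts
    pointwise, and on the fibre at k0, where all weights of the core generators
    are 1, it acts through left multiplication by the given elements. *)
Lemma core_universal :
  exists F : Ucore t r s -> C,
    [/\ linear F, F 1 = 1, forall u v, F (u * v) = F u * F v
      & forall g u, gens_both g -> val u = Ugen r s g -> F u = y g].
Proof.
pose k0 : idx := (0, 0, (false, false)).
have hx := ext_gen_rel.
pose F (u : Ucore t r s) := Ueval ext_gen (val u) (fun=> 1) k0.
have Fgen g (u : Ucore t r s) X : gens_both g -> val u = Ugen r s g ->
    Ueval ext_gen (val u) X k0 = y g * X k0.
  move=> hg ->; rewrite Ueval_gen //; case: g hg => // i _ /=.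
    by rewrite /chi mulr1 expr1n scale1r.
  by rewrite /chi mulr1 expr1n invr1 scale1r.
have FL k (a b : Ucore t r s) X : Ueval ext_gen (val (k *: a + b)) X k0 =
    k *: Ueval ext_gen (val a) X k0 + Ueval ext_gen (val b) X k0.
  by rewrite Usub_valL (Ueval_linear hx).
have FM (a b : Ucore t r s) X : Ueval ext_gen (val (a * b)) X k0 =
    Ueval ext_gen (val a) (Ueval ext_gen (val b) X) k0.
  by rewrite Usub_valM (Ueval_monoid hx).2.
have Fact (u : Ucore t r s) X : Ueval ext_gen (val u) X k0 = F u * X k0.
  elim/Usub_ind: u X => [|k a b IHa IHb|a b IHa IHb|g u hg hu] X.
  - by rewrite /F Usub_val1 (Ueval_monoid hx).1 !endo1E mul1r.
  - by rewrite /F !FL IHa IHb mulrDl scalerAl.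
  - by rewrite /F !FM !IHa !IHb mulrA mulr1.
  - by rewrite /F !(Fgen g) // mulr1.
exists F; split.
- by move=> k a b; rewrite /F FL.
- by rewrite /F Usub_val1 (Ueval_monoid hx).1 endo1E.
- by move=> u v; rewrite /F FM Fact.
- by move=> g u hg hu; rewrite /F (Fgen g) // mulr1.
Qed.
End Universal.

(** * The representation of the halves on the double *)

Section DoubleModule.
Variables (K : fieldType) (A U : algType K) (HA : hopfAlg A) (HU : hopfAlg U).
Variables (p : U -> A -> K) (hp : skew_dual_pairing HA HU p).
Local Notation S := (ant HU).

Lemma pair_linl k f g a : p (k *: f + g) a = k * p f a + p g a.
Proof. by case: hp => -[h _] _ _ _ _; exact: (h a k f g). Qed.
Lemma pair_linr k f a b : p f (k *: a + b) = k * p f a + p f b.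
Proof. by case: hp => -[_ h] _ _ _ _; exact: (h f k a b). Qed.
Lemma pair_unitr f : p f 1 = eps HU f. Proof. by case: hp. Qed.
Lemma pair_unitl a : p 1 a = eps HA a. Proof. by case: hp. Qed.
Lemma pair_mulr f a1 a2 : p f (a1 * a2) =
  tlift (fun f1 f2 => (p f2 a1 * p f1 a2 : K^o)) (cop HU f).
Proof. by case: hp. Qed.
Lemma pair_mull f1 f2 a : p (f1 * f2) a =
  tlift (fun a1 a2 => (p f1 a1 * p f2 a2 : K^o)) (cop HA a).
Proof. by case: hp. Qed.

(** The pairing lets U act on A on both sides through the coproduct of A.
    [ract] is a left action; [lact] is a right action, which the antipode
    turns into a left one. *)
Definition lact (x : U) (a : A) : A :=
  tlift (fun a1 a2 => p x a1 *: a2) (cop HA a).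
Definition ract (x : U) (a : A) : A :=
  tlift (fun a1 a2 => p x a2 *: a1) (cop HA a).

Let bL x : bilin (fun a1 a2 : A => p x a1 *: a2).
Proof.
split=> a k u v /=; first by rewrite pair_linr scalerDl scalerA.
by rewrite scalerDr !scalerA mulrC.
Qed.
Let bR x : bilin (fun a1 a2 : A => p x a2 *: a1).
Proof.
split=> a k u v /=; last by rewrite pair_linr scalerDl scalerA.
by rewrite scalerDr !scalerA mulrC.
Qed.

Lemma lact_linr k x a b : lact x (k *: a + b) = k *: lact x a + lact x b.
Proof. exact: (@cop_tlift_lin _ _ HA _ _ (bL x) k a b). Qed.
Lemma ract_linr k x a b : ract x (k *: a + b) = k *: ract x a + ract x b.
Proof. exact: (@cop_tlift_lin _ _ HA _ _ (bR x) k a b). Qed.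
Lemma lact_linl k x y a : lact (k *: x + y) a = k *: lact x a + lact y a.
Proof.
by rewrite /lact !tliftE; linsum; rewrite pair_linl scalerDl scalerA.
Qed.
Lemma ract_linl k x y a : ract (k *: x + y) a = k *: ract x a + ract y a.
Proof.
by rewrite /ract !tliftE; linsum; rewrite pair_linl scalerDl scalerA.
Qed.

Lemma lact1 a : lact 1 a = a.
Proof.
rewrite -[RHS](@sum_counitl _ _ HA A id a) //.
by apply: eq_tlift => a1 a2; rewrite pair_unitl.
Qed.
Lemma ract1 a : ract 1 a = a.
Proof.
rewrite -[RHS](@sum_counitr _ _ HA A id a) //.
by apply: eq_tlift => a1 a2; rewrite pair_unitl.
Qed.

Let tri1 x y : trilin (fun a b c : A => (p x a * p y b) *: c).
Proof.
split=> ? ? k u v /=; rewrite ?pair_linr.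
- by rewrite scalerA -scalerDl; congr (_ *: _); ring.
- by rewrite scalerA -scalerDl; congr (_ *: _); ring.
- by rewrite scalerDr !scalerA mulrC.
Qed.
Let tri2 x y : trilin (fun a b c : A => (p x b * p y c) *: a).
Proof.
split=> ? ? k u v /=; rewrite ?pair_linr.
- by rewrite scalerDr !scalerA mulrC.
- by rewrite scalerA -scalerDl; congr (_ *: _); ring.
- by rewrite scalerA -scalerDl; congr (_ *: _); ring.
Qed.
Let tri3 x y : trilin (fun a b c : A => (p x a * p y c) *: b).
Proof.
split=> ? ? k u v /=; rewrite ?pair_linr.
- by rewrite scalerA -scalerDl; congr (_ *: _); ring.
- by rewrite scalerDr !scalerA mulrC.
- by rewrite scalerA -scalerDl; congr (_ *: _); ring.
Qed.

Lemma lactM x y a : lact (x * y) a = lact y (lact x a).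
Proof.
rewrite {3}/lact (tlift_comp _ _ (fun k u v => lact_linr k y u v)).
transitivity (tlift (fun u c => tlift (fun a b => (p x a * p y b) *: c)
   (cop HA u)) (cop HA a)).
  apply: eq_tlift => a1 a2; rewrite pair_mull !tliftE scaler_suml.
  by apply: eq_bigr.
rewrite (sum_coassoc _ _ (tri1 x y)); apply: eq_tlift => a1 a2.
rewrite (linZ (fun k u v => lact_linr k y u v)) /lact !tliftE scaler_sumr.
by apply: eq_bigr => q _; rewrite scalerA.
Qed.

Lemma ractM x y a : ract (x * y) a = ract x (ract y a).
Proof.
rewrite {3}/ract (tlift_comp _ _ (fun k u v => ract_linr k x u v)).
transitivity (tlift (fun a u => tlift (fun b c => (p x b * p y c) *: a)
   (cop HA u)) (cop HA a)).
  apply: eq_tlift => a1 a2; rewrite pair_mull !tliftE scaler_suml.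
  by apply: eq_bigr.
rewrite -(sum_coassoc _ _ (tri2 x y)); apply: eq_tlift => a1 a2.
rewrite (linZ (fun k u v => ract_linr k x u v)) /ract !tliftE scaler_sumr.
by apply: eq_bigr => q _; rewrite scalerA mulrC.
Qed.

Lemma lact_ract x y a : lact x (ract y a) = ract y (lact x a).
Proof.
rewrite {2}/lact {1}/ract (tlift_comp _ _ (fun k u v => ract_linr k y u v)).
rewrite (tlift_comp _ _ (fun k u v => lact_linr k x u v)).
transitivity (tlift (fun u c => tlift (fun a b => (p x a * p y c) *: b)
   (cop HA u)) (cop HA a)).
  apply: eq_tlift => a1 a2; rewrite (linZ (fun k u v => lact_linr k x u v)).
  rewrite /lact !tliftE scaler_sumr.
  by apply: eq_bigr => q _; rewrite scalerA mulrC.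
rewrite (sum_coassoc _ _ (tri3 x y)); apply: eq_tlift => a1 a2.
rewrite (linZ (fun k u v => ract_linr k y u v)) /ract !tliftE scaler_sumr.
by apply: eq_bigr => q _; rewrite scalerA.
Qed.

(** A grouplike x thus acts by algebra maps and a skew-primitive one by skew
    derivations. *)
Lemma lact_mul x a b : lact x (a * b) =
  tlift (fun x1 x2 => lact x2 a * lact x1 b) (cop HU x).
Proof.
rewrite {1}/lact tlift_copM; last exact: bL.
rewrite tliftE.
under eq_bigr do rewrite tliftE.
transitivity (\sum_(q <- repr (cop HU x)) \sum_(a' <- repr (cop HA a))
   \sum_(b' <- repr (cop HA b)) (p q.2 a'.1 * p q.1 b'.1) *: (a'.2 * b'.2)).
  rewrite [RHS]exchange_big; apply: eq_bigr => a' _.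
  rewrite [RHS]exchange_big; apply: eq_bigr => b' _.
  by rewrite pair_mulr tliftE scaler_suml.
rewrite tliftE; apply: eq_bigr => q _; rewrite /lact !tliftE mulr_suml.
apply: eq_bigr => a' _; rewrite mulr_sumr; apply: eq_bigr => b' _.
by rewrite -scalerAl -scalerAr scalerA.
Qed.

Lemma ract_mul x a b : ract x (a * b) =
  tlift (fun x1 x2 => ract x2 a * ract x1 b) (cop HU x).
Proof.
rewrite {1}/ract tlift_copM; last exact: bR.
rewrite tliftE.
under eq_bigr do rewrite tliftE.
transitivity (\sum_(q <- repr (cop HU x)) \sum_(a' <- repr (cop HA a))
   \sum_(b' <- repr (cop HA b)) (p q.2 a'.2 * p q.1 b'.2) *: (a'.1 * b'.1)).
  rewrite [RHS]exchange_big; apply: eq_bigr => a' _.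
  rewrite [RHS]exchange_big; apply: eq_bigr => b' _.
  by rewrite pair_mulr tliftE scaler_suml.
rewrite tliftE; apply: eq_bigr => q _; rewrite /ract !tliftE mulr_suml.
apply: eq_bigr => a' _; rewrite mulr_sumr; apply: eq_bigr => b' _.
by rewrite -scalerAl -scalerAr scalerA.
Qed.

Let T := tens A U.

(** Left multiplication by [a (x) 1] in the double. *)
Definition lam (a : A) : T -> T := tmap (fun b => a * b) id.

(** The three factors of the iterated coproduct of an element of U, acting on
    the tensor product of A and U. *)
Definition rho3 (f1 f2 f3 : U) : T -> T :=
  tmap (fun a => lact (S f1) (ract f3 a)) (fun g => f2 * g).

(** Left multiplication by [1 (x) f] in the double. *)
Definition rho (f : U) (x : T) : T :=
  tlift (fun u f3 => tlift (fun f1 f2 => rho3 f1 f2 f3 x) (cop HU u)) (cop HU f).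

Let mulL k (a b c : A) : (k *: a + b) * c = k *: (a * c) + b * c.
Proof. by rewrite mulrDl scalerAl. Qed.
Let mulR k (a b c : A) : c * (k *: a + b) = k *: (c * a) + c * b.
Proof. by rewrite mulrDr scalerAr. Qed.
Let mulLU k (a b c : U) : (k *: a + b) * c = k *: (a * c) + b * c.
Proof. by rewrite mulrDl scalerAl. Qed.
Let mulRU k (a b c : U) : c * (k *: a + b) = k *: (c * a) + c * b.
Proof. by rewrite mulrDr scalerAr. Qed.

Lemma lam_lin a : linear (lam a).
Proof. by apply: tmap_lin => // k u v; rewrite mulR. Qed.
Lemma lam_tens a b g : lam a (tensor b g) = tensor (a * b) g.
Proof. by rewrite /lam tmap_tens // => k u v; rewrite mulR. Qed.
Lemma rho3_lin f1 f2 f3 : linear (rho3 f1 f2 f3).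
Proof.
by apply: tmap_lin => k u v; rewrite ?mulRU // ract_linr lact_linr.
Qed.
Lemma rho3_tens f1 f2 f3 a g :
  rho3 f1 f2 f3 (tensor a g) = tensor (lact (S f1) (ract f3 a)) (f2 * g).
Proof.
by rewrite /rho3 tmap_tens // => k u v; rewrite ?mulRU // ract_linr lact_linr.
Qed.

Let comb_lin k (F G : T -> T) : linear F -> linear G ->
  linear (fun x => k *: F x + G x).
Proof.
move=> hF hG c x y; rewrite hF hG !scalerDr !scalerA [c * k]mulrC addrACA.
by [].
Qed.

Lemma rho3_tri x : trilin (fun f1 f2 f3 => rho3 f1 f2 f3 x).
Proof.
split=> [f2 f3 k u v|f1 f3 k u v|f1 f2 k u v] /=.
- apply: (@tens_linE _ _ _ _ (rho3 (k *: u + v) f2 f3)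
    (fun x => k *: rho3 u f2 f3 x + rho3 v f2 f3 x)).
  + exact: rho3_lin.
  + by apply: comb_lin; exact: rho3_lin.
  + by move=> a g; rewrite !rho3_tens ant_lin lact_linl tensorLl.
- apply: (@tens_linE _ _ _ _ (rho3 f1 (k *: u + v) f3)
    (fun x => k *: rho3 f1 u f3 x + rho3 f1 v f3 x)).
  + exact: rho3_lin.
  + by apply: comb_lin; exact: rho3_lin.
  + by move=> a g; rewrite !rho3_tens mulLU tensorLr.
- apply: (@tens_linE _ _ _ _ (rho3 f1 f2 (k *: u + v))
    (fun x => k *: rho3 f1 f2 u x + rho3 f1 f2 v x)).
  + exact: rho3_lin.
  + by apply: comb_lin; exact: rho3_lin.
  + by move=> a g; rewrite !rho3_tens ract_linl lact_linr tensorLl.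
Qed.

Let bil_inner x f3 : bilin (fun f1 f2 => rho3 f1 f2 f3 x).
Proof. by case: (rho3_tri x) => h1 h2 h3; split=> *; [exact: h1|exact: h2]. Qed.
Let bil_outer x :
  bilin (fun u f3 => tlift (fun f1 f2 => rho3 f1 f2 f3 x) (cop HU u)).
Proof.
case: (rho3_tri x) => h1 h2 h3; split=> [f3|u k f g].
  exact: (@cop_tlift_lin _ _ HU _ _ (bil_inner x f3)).
by rewrite !tliftE; linsum1; rewrite /= h3.
Qed.

Lemma rho_linr f : linear (rho f).
Proof.
move=> k x y; rewrite /rho !tliftE; linsum1; rewrite !tliftE; linsum1.
by rewrite rho3_lin.
Qed.
Lemma rho_linl x : linear (rho^~ x).
Proof. exact: (@cop_tlift_lin _ _ HU _ _ (bil_outer x)). Qed.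

Lemma rho1 x : rho 1 x = x.
Proof.
rewrite /rho cop1 tlift_tens // cop1 tlift_tens //.
apply: (@tens_linE _ _ _ _ (rho3 1 1 1) id) => //; first exact: rho3_lin.
by move=> a g; rewrite rho3_tens ant1 ract1 lact1 mul1r.
Qed.

Lemma rho3M f1 f2 f3 g1 g2 g3 x :
  rho3 (f1 * g1) (f2 * g2) (f3 * g3) x = rho3 f1 f2 f3 (rho3 g1 g2 g3 x).
Proof.
apply: (@tens_linE _ _ _ _ (rho3 (f1 * g1) (f2 * g2) (f3 * g3))
   (fun x => rho3 f1 f2 f3 (rho3 g1 g2 g3 x))).
- exact: rho3_lin.
- by move=> k u v; rewrite !rho3_lin.
- move=> a g; rewrite !rho3_tens antM lactM ractM -mulrA.
  by rewrite [ract f3 (lact _ _)](esym (lact_ract _ _ _)).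
Qed.

(** [rho] is the pull-back, along the multiplicative iterated coproduct, of a
    tensor product of three representations of U. *)
Lemma rhoM f g x : rho (f * g) x = rho f (rho g x).
Proof.
rewrite {1}/rho tlift_copM //; rewrite {1}/rho; apply: eq_tlift => u f3.
transitivity (tlift (fun v g3 => tlift (fun f1 f2 =>
   tlift (fun g1 g2 => rho3 f1 f2 f3 (rho3 g1 g2 g3 x)) (cop HU v)) (cop HU u))
   (cop HU g)).
  apply: eq_tlift => v g3; rewrite tlift_copM //.
  apply: eq_tlift => f1 f2; apply: eq_tlift => g1 g2; exact: rho3M.
rewrite !tliftE; under eq_bigr do rewrite tliftE.
rewrite exchange_big; apply: eq_bigr => q _.
rewrite /rho (tlift_comp _ _ (@rho3_lin _ _ _)); apply: eq_bigr => q' _.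
by rewrite (tlift_comp _ _ (@rho3_lin _ _ _)).
Qed.

Lemma lamM a b x : lam (a * b) x = lam a (lam b x).
Proof.
apply: (@tens_linE _ _ _ _ (lam (a * b)) (fun x => lam a (lam b x))).
- exact: lam_lin.
- by move=> k u v; rewrite !lam_lin.
- by move=> c g; rewrite !lam_tens mulrA.
Qed.
Lemma lam1 x : lam 1 x = x.
Proof.
apply: (@tens_linE _ _ _ _ (lam 1) id) => //; first exact: lam_lin.
by move=> c g; rewrite !lam_tens mul1r.
Qed.
Lemma lam_linl x : linear (lam^~ x).
Proof.
move=> k a b; apply: (@tens_linE _ _ _ _ (lam (k *: a + b))
  (fun x => k *: lam a x + lam b x)).
- exact: lam_lin.
- by apply: comb_lin; exact: lam_lin.
- by move=> c g; rewrite !lam_tens mulL tensorLl.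
Qed.

Lemma rho_unit f : rho f (tensor 1 1) = tensor 1 f.
Proof.
have l1 x : lact x 1 = (eps HU x)%:A.
  by rewrite /lact cop1 tlift_tens ?pair_unitr.
have r1 x : ract x 1 = (eps HU x)%:A.
  by rewrite /ract cop1 tlift_tens ?pair_unitr.
have tR a : linear (fun g : U => tensor a g : T).
  by move=> k u v; rewrite tensorLr.
have tL g : linear (fun a : A => tensor a g : T).
  by move=> k u v; rewrite tensorLl.
rewrite -[RHS](@sum_counitr _ _ HU _ _ f (tR 1)); apply: eq_tlift => u f3.
rewrite -[in RHS](@sum_counitl _ _ HU _ _ u (tR 1)) !tliftE scaler_sumr.
apply: eq_bigr => q _; rewrite rho3_tens r1 mulr1.
rewrite (linZ (fun k u v => lact_linr k _ u v)) l1 eps_ant.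
by rewrite !(linZ (tL _)).
Qed.

Lemma lam_rho_unit a f : lam a (rho f (tensor 1 1)) = tensor a f.
Proof. by rewrite rho_unit lam_tens mulr1. Qed.

(** The product of the double factors through the two representations; with
    [lamM] and [rhoM] this replaces the associativity of the double. *)
Lemma double_mulE x y : double_mul HA HU p x y =
  tlift (fun a f => lam a (rho f y)) x.
Proof.
have rlin f := @rho_linr f; have llin a := @lam_lin a.
have tL g : linear (fun a : A => tensor a g : T).
  by move=> k u v; rewrite tensorLl.
apply: eq_tlift => a f.
transitivity (tlift (fun a' f' => lam a (rho f (tensor a' f'))) y); last first.
  rewrite [in RHS](tens_sum y) (lin_sum (rlin f)) (lin_sum (llin a)).
  by [].
apply: eq_tlift => a' f'.
have h3 : trilin (fun f1 f2 f3 => lam a (rho3 f1 f2 f3 (tensor a' f'))).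
  case: (rho3_tri (tensor a' f')) => h1 h2 h3.
  by split=> ? ? k u v; rewrite -(llin a); congr lam; [exact: h1|exact: h2|exact: h3].
rewrite /rho (tlift_comp _ _ (llin a)).
transitivity (tlift3 (fun f1 f2 f3 => lam a (rho3 f1 f2 f3 (tensor a' f')))
  (cop2 HU f)); last first.
  rewrite tlift3_cop2 //; apply: eq_tlift => u f3.
  by rewrite (tlift_comp _ _ (llin a)).
apply: eq_tlift3 => f1 f2 f3; rewrite rho3_tens lam_tens tlift3_cop2; last first.
  split=> ? ? k u v /=; rewrite ?pair_linr ?mulR ?tensorLl.
  - by rewrite scalerA -scalerDl; congr (_ *: _); ring.
  - by rewrite scalerDr !scalerA mulrC.
  - by rewrite scalerA -scalerDl; congr (_ *: _); ring.
have hl : linear (fun b => tensor (a * lact (S f1) b) (f2 * f') : T).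
  by move=> k u v; rewrite lact_linr mulR tensorLl.
rewrite {1}/ract (tlift_comp _ _ hl); apply: eq_tlift => u a3.
rewrite (linZ hl) /lact.
have hl' : linear (fun b => tensor (a * b) (f2 * f') : T).
  by move=> k v w; rewrite mulR tensorLl.
rewrite (tlift_comp _ _ hl') !tliftE scaler_sumr; apply: eq_bigr => q _.
by rewrite (linZ hl') scalerA mulrC.
Qed.

(** * Commutation of the two halves *)

Section GrouplikeAndSkewPrimitive.
Variables (f w w1 : U).
Hypotheses (cw : cop HU w = tensor w w).

Lemma rho_grouplike a g :
  rho w (tensor a g) = tensor (lact (S w) (ract w a)) (w * g).
Proof.
rewrite /rho cw tlift_tens; last exact: bil_outer.
by rewrite cw tlift_tens ?rho3_tens //; exact: bil_inner.
Qed.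

Lemma lact_grouplikeM a b : lact w (a * b) = lact w a * lact w b.
Proof.
rewrite lact_mul cw tlift_tens //.
by split=> ? k u v; rewrite lact_linl ?mulL ?mulR.
Qed.
Lemma ract_grouplikeM a b : ract w (a * b) = ract w a * ract w b.
Proof.
rewrite ract_mul cw tlift_tens //.
by split=> ? k u v; rewrite ract_linl ?mulL ?mulR.
Qed.

Hypothesis cf : cop HU f = tensor 1 f + tensor f w.

Lemma rho_skewprim a g : rho f (tensor a g) =
  tensor (ract f a) g + tensor (ract w a) (f * g)
  + tensor (lact (S f) (ract w a)) (w * g).
Proof.
have bo := bil_outer (tensor a g); have bi f3 := bil_inner (tensor a g) f3.
rewrite /rho cf (linD (tlift_lin bo)) !tlift_tens // cop1 cf.
rewrite (linD (tlift_lin (bi _))) !tlift_tens // !rho3_tens ant1 !lact1.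
by rewrite mul1r addrA.
Qed.

Lemma ract_skewprimM a b : ract f (a * b) = ract f a * b + ract w a * ract f b.
Proof.
have bb : bilin (fun x1 x2 => ract x2 a * ract x1 b).
  by split=> ? k u v; rewrite ract_linl ?mulL ?mulR.
by rewrite ract_mul cf (linD (tlift_lin bb)) !tlift_tens // ract1.
Qed.

Hypotheses (cw1 : cop HU w1 = tensor w1 w1) (ww1 : w * w1 = 1).
Hypothesis (Sf : S f = - (f * w1)).

(** [S f] is skew-primitive with respect to the inverse of w. *)
Lemma lact_ant_skewprimM a b :
  lact (S f) (a * b) = lact (S f) a * lact w1 b + a * lact (S f) b.
Proof.
have bb : bilin (fun x1 x2 => lact x2 a * lact x1 b).
  by split=> ? k u v; rewrite lact_linl ?mulL ?mulR.
have cg : cop HU (f * w1) = tensor w1 (f * w1) + tensor (f * w1) 1.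
  have bt x y : bilin (fun a b : U => tensor (x * a) (y * b)).
    by split=> ? k u v; rewrite !mulRU ?tensorLl ?tensorLr.
  have bt' : bilin (fun x y =>
      tlift (fun a b : U => tensor (x * a) (y * b)) (cop HU w1)).
    rewrite cw1; split=> ? k u v; rewrite !tlift_tens // mulLU;
      by rewrite ?tensorLl ?tensorLr.
  rewrite copM /tmul cf (linD (tlift_lin bt')) !tlift_tens // cw1 !tlift_tens //.
  by rewrite mul1r ww1.
have lN x c : lact (- x) c = - lact x c.
  by rewrite (linN (f := lact^~ c)) // => k u v; rewrite lact_linl.
rewrite Sf !lN lact_mul cg (linD (tlift_lin bb)) !tlift_tens // lact1.
by rewrite opprD mulNr mulrN.
Qed.
End GrouplikeAndSkewPrimitive.

Lemma lact_grouplike x a : cop HA a = tensor a a -> lact x a = p x a *: a.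
Proof. by move=> ca; rewrite /lact ca tlift_tens //; exact: bL. Qed.
Lemma ract_grouplike x a : cop HA a = tensor a a -> ract x a = p x a *: a.
Proof. by move=> ca; rewrite /ract ca tlift_tens //; exact: bR. Qed.
Lemma lact_skewprim x e w : cop HA e = tensor e 1 + tensor w e ->
  lact x e = p x e *: 1 + p x w *: e.
Proof.
by move=> ce; rewrite /lact ce (linD (tlift_lin (bL x))) !tlift_tens //; exact: bL.
Qed.
Lemma ract_skewprim x e w : cop HA e = tensor e 1 + tensor w e ->
  ract x e = eps HU x *: e + p x e *: w.
Proof.
move=> ce; rewrite /ract ce (linD (tlift_lin (bR x))) !tlift_tens ?pair_unitr //;
  exact: bR.
Qed.

Let bP f1 f2 : bilin (fun a1 a2 : A => (p f1 a1 * p f2 a2 : K^o)).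
Proof.
split=> a k u v /=; rewrite pair_linr.
  by rewrite mulrDl -mulrA.
by rewrite mulrDr mulrCA.
Qed.

Lemma pair_mul_grouplike f1 f2 a : cop HA a = tensor a a ->
  p (f1 * f2) a = p f1 a * p f2 a.
Proof. by move=> ca; rewrite pair_mull ca tlift_tens //; exact: bP. Qed.

Lemma pair_mul_skewprim f1 f2 e w : cop HA e = tensor e 1 + tensor w e ->
  p (f1 * f2) e = p f1 e * eps HU f2 + p f1 w * p f2 e.
Proof.
move=> ce; rewrite pair_mull ce (linD (tlift_lin (bP _ _))) !tlift_tens //;
  by [rewrite pair_unitr | exact: bP].
Qed.

Section CrossRelations.
Variables (f w' v' : U) (e w : A) (c q : K).
Hypotheses (cf : cop HU f = tensor 1 f + tensor f w')
  (cw' : cop HU w' = tensor w' w') (cv' : cop HU v' = tensor v' v')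
  (wv' : w' * v' = 1) (Sf : S f = - (f * v')) (Sw' : S w' = v')
  (ef : eps HU f = 0) (ew' : eps HU w' = 1) (ev' : eps HU v' = 1).
Hypotheses (cw : cop HA w = tensor w w) (ce : cop HA e = tensor e 1 + tensor w e).
Hypotheses (pfe : p f e = c) (pfw : p f w = 0) (pw'e : p w' e = 0)
  (pw'w : p w' w = q) (pv'e : p v' e = 0) (pv'w : p v' w = q^-1).

Let tZ k a g : tensor (k *: a) g = k *: tensor a g :> T.
Proof. by rewrite (linZ (fun k u v => tensorLl k u v g)). Qed.
Let tD a b g : tensor (a + b) g = tensor a g + tensor b g :> T.
Proof. by rewrite (linD (fun k u v => tensorLl k u v g)). Qed.

Let lactZ x k a : lact x (k *: a) = k *: lact x a.
Proof. exact: (linZ (fun k u v => lact_linr k x u v)). Qed.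

Lemma rho_lam_skew_grouplike m : rho f (lam w m) = q *: lam w (rho f m).
Proof.
apply: (@tens_linE _ _ _ _ (fun m => rho f (lam w m)) (fun m => q *: lam w (rho f m))).
- by move=> k u v; rewrite lam_lin rho_linr.
- by move=> k u v; rewrite rho_linr lam_lin scalerDr !scalerA mulrC.
move=> a g; rewrite lam_tens !(rho_skewprim cf).
rewrite (ract_skewprimM cf) (ract_grouplikeM cw') !(ract_grouplike _ cw) pfw pw'w.
rewrite scale0r mul0r add0r -!scalerAl lactZ (lact_ant_skewprimM cf cv' wv' Sf).
have -> : lact (S f) w = 0.
  rewrite (lact_grouplike _ cw) Sf.
  have lN x b : p (- x) b = - p x b.
    by rewrite (linN (f := (p^~ b : U -> K^o))) // => k u v; exact: pair_linl.
  by rewrite lN pair_mul_grouplike // pfw mul0r oppr0 scale0r.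
rewrite mul0r add0r !tZ -!scalerDr !(linD (lam_lin _)) !lam_tens.
by [].
Qed.

Lemma rho_lam_grouplike_skew m : rho w' (lam e m) = q^-1 *: lam e (rho w' m).
Proof.
apply: (@tens_linE _ _ _ _ (fun m => rho w' (lam e m))
  (fun m => q^-1 *: lam e (rho w' m))).
- by move=> k u v; rewrite lam_lin rho_linr.
- by move=> k u v; rewrite rho_linr lam_lin scalerDr !scalerA mulrC.
move=> a g; rewrite lam_tens !(rho_grouplike cw') Sw' (ract_grouplikeM cw').
rewrite (ract_skewprim _ ce) ew' pw'e scale0r addr0 scale1r (lact_grouplikeM cv').
by rewrite (lact_skewprim _ ce) pv'e pv'w scale0r add0r lam_tens -scalerAl tZ.
Qed.

(** The only relation that sees both ends of the coproduct of f: the term of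
    [ract f e] yields w, the term of [lact (S f) e] yields w'. *)
Lemma rho_lam_skew_skew m :
  rho f (lam e m) = lam e (rho f m) + c *: (lam w m - rho w' m).
Proof.
apply: (@tens_linE _ _ _ _ (fun m => rho f (lam e m))
  (fun m => lam e (rho f m) + c *: (lam w m - rho w' m))).
- by move=> k u v; rewrite lam_lin rho_linr.
- move=> k u v; rewrite !rho_linr !lam_lin opprD addrACA -scalerN.
  rewrite -scalerDr [c *: (k *: _ + _)]scalerDr !scalerA mulrC -scalerA addrACA.
  by rewrite -scalerDr.
move=> a g; rewrite !lam_tens !(rho_skewprim cf) (rho_grouplike cw') Sw'.
rewrite (ract_skewprimM cf) (ract_grouplikeM cw') !(ract_skewprim _ ce) pfe pw'e.
rewrite ef ew' !scale0r add0r scale1r addr0 (lact_ant_skewprimM cf cv' wv' Sf).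
have lN x b : p (- x) b = - p x b.
  by rewrite (linN (f := (p^~ b : U -> K^o))) // => k u v; exact: pair_linl.
have -> : lact (S f) e = - c *: 1.
  rewrite (lact_skewprim _ ce) Sf !lN (pair_mul_grouplike _ _ cw) pfw.
  rewrite mul0r oppr0 scale0r addr0.
  by rewrite (pair_mul_skewprim _ _ ce) ev' pfw pfe mulr1 mul0r addr0.
rewrite -!scalerAl mul1r !tD !tZ !(linD (lam_lin _)) !lam_tens scaleNr scalerBr.
set X1 := c *: tensor (w * a) g; set X2 := c *: _.
rewrite [X1 + _]addrC -!addrA; congr (_ + _); rewrite addrCA; congr (_ + _).
by rewrite addrA addrC.
Qed.
End CrossRelations.

Lemma rho_lam_grouplike x y a m : cop HU x = tensor x x -> cop HU y = tensor y y ->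
  S x = y -> y * x = 1 -> cop HA a = tensor a a -> eps HA a = 1 ->
  rho x (lam a m) = lam a (rho x m).
Proof.
move=> cx cy Sx yx ca ea.
apply: (@tens_linE _ _ _ _ (fun m => rho x (lam a m)) (fun m => lam a (rho x m))).
- by move=> k u v; rewrite lam_lin rho_linr.
- by move=> k u v; rewrite rho_linr lam_lin.
move=> b g; rewrite lam_tens !(rho_grouplike cx) Sx (ract_grouplikeM cx).
rewrite (lact_grouplikeM cy) (ract_grouplike _ ca) lam_tens; congr (tensor (_ * _) _).
rewrite (linZ (fun k u v => lact_linr k y u v)) (lact_grouplike _ ca) scalerA mulrC.
by rewrite -pair_mul_grouplike // yx pair_unitl ea scale1r.
Qed.

Lemma tensor11_neq0 : tensor 1 1 != 0 :> T.
Proof.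
have bb : bilin (fun a f => (eps HA a * eps HU f : K^o)).
  split=> b k u v; rewrite eps_lin ?mulrDl ?mulrDr -?mulrA //.
  by congr (_ + _); rewrite mulrCA.
apply/eqP => /(congr1 (tlift (fun a f => (eps HA a * eps HU f : K^o)))).
rewrite tlift_tens // (lin0 (tlift_lin bb)) !eps1 mulr1 => /eqP.
by rewrite oner_eq0.
Qed.

End DoubleModule.

(** * Inclusions between Hopf subalgebras *)

Section SubalgebraMaps.
Variables (K : fieldType) (t : aff_type) (r s : K).
Local Notation G := (Ugen r s).

Section Generators.
Variable P : gen t -> bool.
Local Notation B := (Usub r s P).

Definition Usub_gen (g : gen t) : B := insubd (0 : B) (G g).

Lemma val_Usub_gen g : P g -> val (Usub_gen g) = G g.
Proof.
move=> Pg; rewrite val_insubd ifT //; apply/asboolP => S hS; apply; by exists g.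
Qed.

Lemma Usub_genP g (a : B) : P g -> val a = G g -> a = Usub_gen g.
Proof. by move=> Pg ha; apply: val_inj; rewrite ha val_Usub_gen. Qed.
End Generators.

Section Inclusion.
Variables P P' : gen t -> bool.
Hypothesis PP' : forall g, P g -> P' g.
Local Notation B := (Usub r s P).
Local Notation B' := (Usub r s P').

Definition Usub_incl (a : B) : B' := insubd (0 : B') (val a).

Lemma val_Usub_incl a : val (Usub_incl a) = val a.
Proof.
rewrite val_insubd ifT //; case: a => u /= /asboolP hu.
by apply/asboolP => S hS hX; apply: hu => // x [g Pg ->]; apply: hX; exists g; auto.
Qed.

Lemma Usub_incl_lin : linear Usub_incl.
Proof.
by move=> k a b; apply: val_inj; rewrite Usub_valL !val_Usub_incl.
Qed.
Lemma Usub_inclM a b : Usub_incl (a * b) = Usub_incl a * Usub_incl b.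
Proof. by apply: val_inj; rewrite Usub_valM !val_Usub_incl. Qed.
Lemma Usub_incl1 : Usub_incl 1 = 1.
Proof. by apply: val_inj; rewrite val_Usub_incl. Qed.
Lemma Usub_incl_gen g : P g -> Usub_incl (Usub_gen P g) = Usub_gen P' g.
Proof.
by move=> Pg; apply: val_inj; rewrite val_Usub_incl !val_Usub_gen //; apply: PP'.
Qed.

Section HopfInclusion.
Variables (H : hopfAlg B) (H' : hopfAlg B').
Hypotheses (H_std : std_hopf H) (H'_std : std_hopf H').
Hypothesis P_core : forall g, P g -> gens_both g.
Hypothesis P_sat : forall i, [/\ P (ge i) -> P (gw i), P (gf i) -> P (gw' i),
  P (gw i) = P (gwV i) & P (gw' i) = P (gwV' i)].
Local Notation i := Usub_incl.
Local Notation x := (Usub_gen P).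
Local Notation y := (Usub_gen P').

(** On a generator the standard structure maps are given by the same
    polynomials in the generators on both sides. *)
Lemma incl_gen_compat g : P g ->
  [/\ cop H' (i (x g)) = tmap i i (cop H (x g)),
      eps H' (i (x g)) = eps H (x g)
    & ant H' (i (x g)) = i (ant H (x g))].
Proof.
have ve h : P h -> val (x h) = G h by exact: val_Usub_gen.
have ve' h : P h -> val (i (x h)) = G h by move=> Ph; rewrite val_Usub_incl ve.
have il := Usub_incl_lin; have tl := tmap_lin il il.
have tt a b : tmap i i (tensor a b) = tensor (i a) (i b) by rewrite tmap_tens.
move=> Pg; have := P_core Pg; case: g Pg => // j Pj _.
- have [/(_ Pj) Pw _ Pv _] := P_sat j; have Pw' := Pw; rewrite Pv in Pw'.
  have [h _ _] := H_std j; have [h' _ _] := H'_std j.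
  have [-> -> ->] := h _ _ _ (ve _ Pj) (ve _ Pw) (ve _ Pw').
  have [-> -> ->] := h' _ _ _ (ve' _ Pj) (ve' _ Pw) (ve' _ Pw').
  by rewrite (linD tl) !tt Usub_incl1 (linN il) Usub_inclM.
- have [_ /(_ Pj) Pw _ Pv] := P_sat j; have Pw' := Pw; rewrite Pv in Pw'.
  have [_ h _] := H_std j; have [_ h' _] := H'_std j.
  have [-> -> ->] := h _ _ _ (ve _ Pj) (ve _ Pw) (ve _ Pw').
  have [-> -> ->] := h' _ _ _ (ve' _ Pj) (ve' _ Pw) (ve' _ Pw').
  by rewrite (linD tl) !tt Usub_incl1 (linN il) Usub_inclM.
- have [_ _ Pv _] := P_sat j; have Pj' := Pj; rewrite Pv in Pj'.
  have [_ _ h] := H_std j; have [_ _ h'] := H'_std j.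
  have [[c1 c2] [e1 e2] [a1 a2]] := h _ _ (or_introl (conj (ve _ Pj) (ve _ Pj'))).
  have [[d1 d2] [f1 f2] [b1 b2]] := h' _ _ (or_introl (conj (ve' _ Pj) (ve' _ Pj'))).
  by rewrite c1 d1 e1 f1 a1 b1 tt.
- have [_ _ Pv _] := P_sat j; have Pj' := Pj; rewrite -Pv in Pj'.
  have [_ _ h] := H_std j; have [_ _ h'] := H'_std j.
  have [[c1 c2] [e1 e2] [a1 a2]] := h _ _ (or_introl (conj (ve _ Pj') (ve _ Pj))).
  have [[d1 d2] [f1 f2] [b1 b2]] := h' _ _ (or_introl (conj (ve' _ Pj') (ve' _ Pj))).
  by rewrite c2 d2 e2 f2 a2 b2 tt.
- have [_ _ _ Pv] := P_sat j; have Pj' := Pj; rewrite Pv in Pj'.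
  have [_ _ h] := H_std j; have [_ _ h'] := H'_std j.
  have [[c1 c2] [e1 e2] [a1 a2]] := h _ _ (or_intror (conj (ve _ Pj) (ve _ Pj'))).
  have [[d1 d2] [f1 f2] [b1 b2]] := h' _ _ (or_intror (conj (ve' _ Pj) (ve' _ Pj'))).
  by rewrite c1 d1 e1 f1 a1 b1 tt.
- have [_ _ _ Pv] := P_sat j; have Pj' := Pj; rewrite -Pv in Pj'.
  have [_ _ h] := H_std j; have [_ _ h'] := H'_std j.
  have [[c1 c2] [e1 e2] [a1 a2]] := h _ _ (or_intror (conj (ve _ Pj') (ve _ Pj))).
  have [[d1 d2] [f1 f2] [b1 b2]] := h' _ _ (or_intror (conj (ve' _ Pj') (ve' _ Pj))).
  by rewrite c2 d2 e2 f2 a2 b2 tt.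
Qed.

(** The coproduct and counit are multiplicative and the antipode is
    antimultiplicative, so agreement on generators suffices. *)
Lemma incl_hopf a :
  [/\ cop H' (i a) = tmap i i (cop H a), eps H' (i a) = eps H a
    & ant H' (i a) = i (ant H a)].
Proof.
have il := Usub_incl_lin; have tl := tmap_lin il il.
elim/Usub_ind: a => [|k a b [a1 a2 a3] [b1 b2 b3]|a b [a1 a2 a3] [b1 b2 b3]|g a Pg].
- by rewrite Usub_incl1 !cop1 tmap_tens // !eps1 !ant1 !Usub_incl1.
- by rewrite !il !cop_lin !eps_lin !ant_lin tl il a1 a2 a3 b1 b2 b3.
- rewrite !Usub_inclM !copM !epsM !antM Usub_inclM a1 a2 a3 b1 b2 b3; split=> //.
  rewrite /tmul tlift_tmap; last first.
    split=> w k u v; rewrite !tliftE; linsum;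
      by rewrite ?mulrDl -?scalerAl ?tensorLl ?tensorLr.
  rewrite (tlift_comp _ _ tl); apply: eq_tlift => u v.
  rewrite tlift_tmap; last first.
    by split=> w k u' v'; rewrite ?mulrDr -?scalerAr ?tensorLl ?tensorLr.
  rewrite (tlift_comp _ _ tl); apply: eq_tlift => u' v'.
  by rewrite tmap_tens // !Usub_inclM.
- by move/Usub_genP => -> //; apply: incl_gen_compat.
Qed.
End HopfInclusion.
End Inclusion.
End SubalgebraMaps.

(** * The isomorphism *)

Section Comparison.
Variables (K : fieldType) (r s : K) (t : aff_type).
Hypotheses (r_neq0 : r != 0) (s_neq0 : s != 0) (rs_neq : r ^+ 2 != s ^+ 2).
Variables (HU : hopfAlg (Ucore t r s)) (HU_std : std_hopf HU).
Variables (HB : hopfAlg (Bplus t r s)) (HB_std : std_hopf HB).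
Variables (HB' : hopfAlg (Bminus t r s)) (HB'_std : std_hopf HB').
Variables (p : Bminus t r s -> Bplus t r s -> K).
Hypotheses (p_skew : skew_dual_pairing HB HB' p) (p_std : std_pairing p).

Local Notation B := (Bplus t r s).
Local Notation B' := (Bminus t r s).
Local Notation T := (tens B B').
Local Notation G := (Ugen r s).
Local Notation bp := (Usub_gen r s (@gens_plus t)).
Local Notation bm := (Usub_gen r s (@gens_minus t)).

Let T_neq0 : exists x : T, x != 0.
Proof. by exists (tensor 1 1); exact: tensor11_neq0 HB HB'. Qed.

Local Notation E := (endo T_neq0).

Definition lamE (a : B) : E := Linop (@lam_lin _ _ B' a).
Definition rhoE (f : B') : E := Linop (rho_linr p_skew f).

Lemma lamE_lin : linear lamE.
Proof. by move=> k a b; apply: endoP => m; rewrite !endoE /= lam_linl. Qed.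
Lemma rhoE_lin : linear rhoE.
Proof. by move=> k a b; apply: endoP => m; rewrite !endoE /= rho_linl. Qed.
Lemma lamEM a b : lamE (a * b) = lamE a * lamE b.
Proof. by apply: endoP => m; rewrite !endoE /= lamM. Qed.
Lemma rhoEM a b : rhoE (a * b) = rhoE a * rhoE b.
Proof. by apply: endoP => m; rewrite !endoE /= rhoM. Qed.
Lemma lamE1 : lamE 1 = 1.
Proof. by apply: endoP => m; rewrite !endoE /= lam1. Qed.
Lemma rhoE1 : rhoE 1 = 1.
Proof. by apply: endoP => m; rewrite !endoE /= rho1. Qed.

Definition double_gen (g : gen t) : E :=
  if gens_plus g then lamE (bp g) else rhoE (bm g).

Let vp g : gens_plus g -> val (bp g) = G g.
Proof. exact: val_Usub_gen. Qed.
Let vm g : gens_minus g -> val (bm g) = G g.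
Proof. exact: val_Usub_gen. Qed.

Let UR := Ugen_rel t r s.

Let bp_inv i : bp (gw i) * bp (gwV i) = 1 /\ bp (gwV i) * bp (gw i) = 1.
Proof.
have [h1 h2] := rel_inv_w UR i.
by split; apply: val_inj; rewrite Usub_valM !vp ?Usub_val1.
Qed.
Let bm_inv i : bm (gw' i) * bm (gwV' i) = 1 /\ bm (gwV' i) * bm (gw' i) = 1.
Proof.
have [h1 h2] := rel_inv_w' UR i.
by split; apply: val_inj; rewrite Usub_valM !vm ?Usub_val1.
Qed.
Let UvalZ (P : gen t -> bool) k (a : Usub r s P) : val (k *: a) = k *: val a.
Proof. by []. Qed.
Let bp_we i j : bp (gw j) * bp (ge i) * bp (gwV j) = sc t r s i j *: bp (ge i).
Proof. by apply: val_inj; rewrite UvalZ !Usub_valM !vp //; exact: rel_we UR i j. Qed.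
Let bm_wf i j : bm (gw' j) * bm (gf i) * bm (gwV' j) = sc t r s j i *: bm (gf i).
Proof. by apply: val_inj; rewrite UvalZ !Usub_valM !vm //; exact: rel_wf' UR i j. Qed.

Let cop_e i : cop HB (bp (ge i)) =
  tensor (bp (ge i)) 1 + tensor (bp (gw i)) (bp (ge i)).
Proof.
have [h _ _] := HB_std i.
by have [] := h _ _ _ (vp (g:=ge i) erefl) (vp (g:=gw i) erefl)
  (vp (g:=gwV i) erefl).
Qed.
Let hopf_w i := let: And3 _ _ h := HB_std i in
  h _ _ (or_introl (conj (vp (g:=gw i) erefl) (vp (g:=gwV i) erefl))).
Let cop_w i : cop HB (bp (gw i)) = tensor (bp (gw i)) (bp (gw i)).
Proof. by have [[]] := hopf_w i. Qed.
Let cop_v i : cop HB (bp (gwV i)) = tensor (bp (gwV i)) (bp (gwV i)).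
Proof. by have [[]] := hopf_w i. Qed.
Let eps_w i : eps HB (bp (gw i)) = 1.
Proof. by have [_ []] := hopf_w i. Qed.
Let eps_v i : eps HB (bp (gwV i)) = 1.
Proof. by have [_ []] := hopf_w i. Qed.

Let hopf_f i := let: And3 _ h _ := HB'_std i in
  h _ _ _ (vm (g:=gf i) erefl) (vm (g:=gw' i) erefl) (vm (g:=gwV' i) erefl).
Let hopf_w' i := let: And3 _ _ h := HB'_std i in
  h _ _ (or_intror (conj (vm (g:=gw' i) erefl) (vm (g:=gwV' i) erefl))).
Let cop_f i : cop HB' (bm (gf i)) =
  tensor 1 (bm (gf i)) + tensor (bm (gf i)) (bm (gw' i)).
Proof. by have [] := hopf_f i. Qed.
Let eps_f i : eps HB' (bm (gf i)) = 0.
Proof. by have [] := hopf_f i. Qed.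
Let ant_f i : ant HB' (bm (gf i)) = - (bm (gf i) * bm (gwV' i)).
Proof. by have [] := hopf_f i. Qed.
Let cop_w' i : cop HB' (bm (gw' i)) = tensor (bm (gw' i)) (bm (gw' i)).
Proof. by have [[]] := hopf_w' i. Qed.
Let cop_v' i : cop HB' (bm (gwV' i)) = tensor (bm (gwV' i)) (bm (gwV' i)).
Proof. by have [[]] := hopf_w' i. Qed.
Let eps_w' i : eps HB' (bm (gw' i)) = 1.
Proof. by have [_ []] := hopf_w' i. Qed.
Let eps_v' i : eps HB' (bm (gwV' i)) = 1.
Proof. by have [_ []] := hopf_w' i. Qed.
Let ant_w' i : ant HB' (bm (gw' i)) = bm (gwV' i).
Proof. by have [_ _ []] := hopf_w' i. Qed.
Let ant_v' i : ant HB' (bm (gwV' i)) = bm (gw' i).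
Proof. by have [_ _ []] := hopf_w' i. Qed.

Let pair_values i j := p_std (vm (g:=gf i) erefl) (vm (g:=gw' i) erefl)
  (vm (g:=gwV' i) erefl) (vp (g:=ge j) erefl) (vp (g:=gw j) erefl)
  (vp (g:=gwV j) erefl).

(* <w'_i, w_j> and its inverse multiply to <1, w_j> = 1. *)
Let sc_neq0 (i j : node t) : sc t r s i j != 0.
Proof.
have [_ [_ hw _] [_ hv _]] := pair_values i j.
have : p (bm (gw' i) * bm (gwV' i)) (bp (gw j)) = 1.
  by rewrite (bm_inv i).1 (pair_unitl p_skew) eps_w.
rewrite (pair_mul_grouplike p_skew) // hw hv => h; apply/eqP => h0.
by move: h; rewrite h0 mul0r => /esym/eqP; rewrite oner_eq0.
Qed.

Let r_neq_s : s - r != 0.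
Proof. by apply: contra rs_neq; rewrite subr_eq0 => /eqP ->. Qed.

(* <f_i, e_i> = 1 / (s - r) is not zero. *)
Let e_neq0 i : bp (ge i) != 0.
Proof.
have [[h _ _] _ _] := pair_values i i; apply/eqP => e0; move: h.
rewrite e0 (lin0 (f := (p (bm (gf i)) : _ -> K^o))) => [/eqP|k a b]; last first.
  exact: pair_linr p_skew _ _ _ _.
by rewrite eqxx mul1r eq_sym invr_eq0 (negPf r_neq_s).
Qed.
Let f_neq0 i : bm (gf i) != 0.
Proof.
have [[h _ _] _ _] := pair_values i i; apply/eqP => e0; move: h.
rewrite e0 (lin0 (f := (p^~ (bp (ge i)) : _ -> K^o))) => [/eqP|k a b]; last first.
  exact: pair_linl p_skew _ _ _ _.
by rewrite eqxx mul1r eq_sym invr_eq0 (negPf r_neq_s).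
Qed.

Let zp := \prod_(i : node t) bp (gwV i) ^+ mark t i.
Let zm := \prod_(i : node t) bm (gwV' i) ^+ mark t i.

Let val_prod (P : gen t -> bool) (F : node t -> Usub r s P) :
  val (\prod_(i : node t) F i ^+ mark t i) = \prod_(i : node t) val (F i) ^+ mark t i.
Proof.
rewrite (big_morph (val : Usub r s P -> _) (@Usub_valM _ _ _ _ P) (Usub_val1 _ _ _)).
apply: eq_bigr => i _; elim: (mark t i) => // n IH.
by rewrite !exprS Usub_valM IH.
Qed.

Let zp_central a : zp * a = a * zp.
Proof.
have vz : val zp = G ga' ^+ 2.
  by rewrite (rel_gamma' UR) val_prod; apply: eq_bigr => i _; rewrite vp.
elim/Usub_ind: a => [|k a b ha hb|a b ha hb|g a Pg ag].
- by rewrite mulr1 mul1r.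
- by rewrite mulrDr mulrDl -scalerAl -scalerAr ha hb.
- by rewrite mulrA ha -mulrA hb mulrA.
- apply: val_inj; rewrite !Usub_valM vz ag.
  by apply/esym/commrX/esym; exact: (rel_central UR).
Qed.
Let zm_central a : zm * a = a * zm.
Proof.
have vz : val zm = G ga ^+ 2.
  by rewrite (rel_gamma UR) val_prod; apply: eq_bigr => i _; rewrite vm.
elim/Usub_ind: a => [|k a b ha hb|a b ha hb|g a Pg ag].
- by rewrite mulr1 mul1r.
- by rewrite mulrDr mulrDl -scalerAl -scalerAr ha hb.
- by rewrite mulrA ha -mulrA hb mulrA.
- apply: val_inj; rewrite !Usub_valM vz ag.
  by apply/esym/commrX/esym; exact: (rel_central UR).
Qed.

Let bp_toral g h : gens_plus g -> gens_plus h -> toral g -> toral h ->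
  bp g * bp h = bp h * bp g.
Proof.
by move=> *; apply: val_inj; rewrite !Usub_valM !vp //; exact: (rel_toral UR).
Qed.
Let bm_toral g h : gens_minus g -> gens_minus h -> toral g -> toral h ->
  bm g * bm h = bm h * bm g.
Proof.
by move=> *; apply: val_inj; rewrite !Usub_valM !vm //; exact: (rel_toral UR).
Qed.

Let bp_ve i j : bp (gwV j) * bp (ge i) =
  (sc t r s i j)^-1 *: (bp (ge i) * bp (gwV j)).
Proof.
rewrite -[bp (ge i) * _]mul1r -(bp_inv j).2 -!mulrA [bp (gw j) * _]mulrA bp_we.
by rewrite -scalerAr scalerA mulVf ?scale1r.
Qed.
Let bm_vf i j : bm (gwV' j) * bm (gf i) =
  (sc t r s j i)^-1 *: (bm (gf i) * bm (gwV' j)).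
Proof.
rewrite -[bm (gf i) * _]mul1r -(bm_inv j).2 -!mulrA [bm (gw' j) * _]mulrA bm_wf.
by rewrite -scalerAr scalerA mulVf ?scale1r.
Qed.

(* gamma' commutes with e_i in U and multiplies it by this product; the
   product is 1 because e_i is not zero.  The same scalar measures the
   commutation of gamma' with f_i, to which no relation inside B applies. *)
Let prod_row (i : node t) : \prod_(j : node t) (sc t r s i j)^-1 ^+ mark t j = 1.
Proof.
have := prod_skew_comm (fun j : node t => mark t j) (bp_ve i).
rewrite -/zp zp_central => h.
have {}h : bp (ge i) =
    (\prod_(j : node t) (sc t r s i j)^-1 ^+ mark t j) *: bp (ge i).
  have zz : zp * (\prod_(i : node t) bp (gw i) ^+ mark t i) = 1.
    by apply: prod_pow_inv => *; [exact: (bp_inv _).2 | exact: bp_toral..].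
  by rewrite -[LHS]mulr1 -zz mulrA h -scalerAl -mulrA zz mulr1.
apply/eqP; rewrite -subr_eq0; move/eqP: h; rewrite eq_sym -subr_eq0.
rewrite -{2}[bp (ge i)]scale1r -scalerBl scaler_eq0 (negPf (e_neq0 i)) orbF.
by [].
Qed.
(* The same with gamma and f_i in place of gamma' and e_i. *)
Let prod_col (i : node t) : \prod_(j : node t) (sc t r s j i)^-1 ^+ mark t j = 1.
Proof.
have := prod_skew_comm (fun j : node t => mark t j) (bm_vf i).
rewrite -/zm zm_central => h.
have {}h : bm (gf i) =
    (\prod_(j : node t) (sc t r s j i)^-1 ^+ mark t j) *: bm (gf i).
  have zz : zm * (\prod_(i : node t) bm (gw' i) ^+ mark t i) = 1.
    by apply: prod_pow_inv => *; [exact: (bm_inv _).2 | exact: bm_toral..].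
  by rewrite -[LHS]mulr1 -zz mulrA h -scalerAl -mulrA zz mulr1.
apply/eqP; rewrite -subr_eq0; move/eqP: h; rewrite eq_sym -subr_eq0.
rewrite -{2}[bm (gf i)]scale1r -scalerBl scaler_eq0 (negPf (f_neq0 i)) orbF.
by [].
Qed.


Let cross_fw (i j : node t) : rhoE (bm (gf i)) * lamE (bp (gw j)) =
  sc t r s i j *: (lamE (bp (gw j)) * rhoE (bm (gf i))).
Proof.
have [[h1 h2 h3] [h4 h5 h6] [h7 h8 h9]] := pair_values i j.
apply: endoP => m; exact: (rho_lam_skew_grouplike p_skew (cop_f i) (cop_w' i)
  (cop_v' i) (bm_inv i).1 (ant_f i) (cop_w j) h2 h5 m).
Qed.

Let cross_we' (i j : node t) : rhoE (bm (gw' i)) * lamE (bp (ge j)) =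
  (sc t r s i j)^-1 *: (lamE (bp (ge j)) * rhoE (bm (gw' i))).
Proof.
have [[h1 h2 h3] [h4 h5 h6] [h7 h8 h9]] := pair_values i j.
apply: endoP => m; exact: (rho_lam_grouplike_skew p_skew (cop_w' i)
  (cop_v' i) (ant_w' i) (eps_w' i) (cop_e j) h4 h7 h8 m).
Qed.

Let cross_fe (i j : node t) : rhoE (bm (gf i)) * lamE (bp (ge j)) =
  lamE (bp (ge j)) * rhoE (bm (gf i))
  + ((i == j)%:R / (s - r)) *: (lamE (bp (gw j)) - rhoE (bm (gw' i))).
Proof.
have [[h1 h2 h3] [h4 h5 h6] [h7 h8 h9]] := pair_values i j.
apply: endoP => m; exact: (rho_lam_skew_skew p_skew (cop_f i) (cop_w' i)
  (cop_v' i) (bm_inv i).1 (ant_f i) (ant_w' i) (eps_f i) (eps_w' i) (eps_v' i)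
  (cop_w j) (cop_e j) h1 h2 h4 m).
Qed.

Let cross_toral g h : gens_minus g -> toral g -> gens_plus h -> toral h ->
  rhoE (bm g) * lamE (bp h) = lamE (bp h) * rhoE (bm g).
Proof.
move=> mg tg ph th; apply: endoP => m; rewrite !endoE /=.
have [[y [cg [cy sg yg]]] [ch eh]] : (exists y,
   cop HB' (bm g) = tensor (bm g) (bm g) /\
   [/\ cop HB' y = tensor y y, ant HB' (bm g) = y & y * bm g = 1]) /\
   (cop HB (bp h) = tensor (bp h) (bp h) /\ eps HB (bp h) = 1); last first.
  exact: (rho_lam_grouplike p_skew _ cg cy sg yg ch eh).
split; first case: g mg tg => // i _ _.
- by exists (bm (gwV' i)); rewrite cop_w' cop_v' ant_w' (bm_inv i).2.
- by exists (bm (gw' i)); rewrite cop_w' cop_v' ant_v' (bm_inv i).1.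
- by case: h ph th => // i _ _; rewrite ?cop_w ?cop_v ?eps_w ?eps_v.
Qed.

Let lam_inv i : lamE (bp (gw i)) * lamE (bp (gwV i)) = 1 /\
  lamE (bp (gwV i)) * lamE (bp (gw i)) = 1.
Proof. by have [h1 h2] := bp_inv i; rewrite -!lamEM h1 h2 lamE1. Qed.
Let rho_inv i : rhoE (bm (gw' i)) * rhoE (bm (gwV' i)) = 1 /\
  rhoE (bm (gwV' i)) * rhoE (bm (gw' i)) = 1.
Proof. by have [h1 h2] := bm_inv i; rewrite -!rhoEM h1 h2 rhoE1. Qed.

Let cross_wf (i j : node t) : lamE (bp (gw j)) * rhoE (bm (gf i)) =
  (sc t r s i j)^-1 *: (rhoE (bm (gf i)) * lamE (bp (gw j))).
Proof. by rewrite cross_fw scalerA mulVf ?scale1r. Qed.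

Let lam_zp : \prod_(i : node t) lamE (bp (gwV i)) ^+ mark t i = lamE zp.
Proof.
rewrite [RHS](big_morph lamE lamEM lamE1); apply: eq_bigr => i _.
by elim: (mark t i) => [|n IH]; rewrite ?expr0 ?lamE1 // !exprS IH lamEM.
Qed.
Let rho_zm : \prod_(i : node t) rhoE (bm (gwV' i)) ^+ mark t i = rhoE zm.
Proof.
rewrite [RHS](big_morph rhoE rhoEM rhoE1); apply: eq_bigr => i _.
by elim: (mark t i) => [|n IH]; rewrite ?expr0 ?rhoE1 // !exprS IH rhoEM.
Qed.

(** The relations inside B and inside B' are inherited from U through the
    representations; the mixed ones are the cross relations above. *)
Lemma double_core_rel : core_rel r s double_gen.
Proof.
split; rewrite /double_gen /=.
- exact: lam_inv.
- exact: rho_inv.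
- case=> //= i; case=> //= j _ _ _ _; rewrite -?lamEM -?rhoEM ?(cross_toral) //;
    by [congr lamE; apply: bp_toral | congr rhoE; apply: bm_toral].
- rewrite lam_zp; case=> //= i _; rewrite -?lamEM ?zp_central // -lam_zp.
  + have hc j := skew_comm_inv (invr_neq0 (sc_neq0 i j)) (lam_inv j).1 (lam_inv j).2
      (cross_wf i j).
    rewrite (prod_skew_comm (fun j : node t => mark t j) hc).
    under eq_bigr do rewrite invrK.
    by rewrite (prod_expV_eq1 (prod_row i)) scale1r.
  + by apply/esym/commr_prod => j _; apply: commrX; exact: cross_toral.
  + by apply/esym/commr_prod => j _; apply: commrX; exact: cross_toral.
- rewrite rho_zm; case=> //= i _; rewrite -?rhoEM ?zm_central // -rho_zm.
  + have hc j := skew_comm_inv (invr_neq0 (sc_neq0 j i)) (rho_inv j).1 (rho_inv j).2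
      (cross_we' j i).
    rewrite (prod_skew_comm (fun j : node t => mark t j) hc).
    under eq_bigr do rewrite invrK.
    by rewrite (prod_expV_eq1 (prod_col i)) scale1r.
  + by apply/esym/commr_prod => j _; apply: commrX; apply/esym; exact: cross_toral.
  + by apply/esym/commr_prod => j _; apply: commrX; apply/esym; exact: cross_toral.
- by move=> i j; rewrite -!lamEM bp_we (linZ lamE_lin).
- by move=> i j; exact: skew_comm_conj (lam_inv j).1 (cross_wf i j).
- by move=> i j; exact: skew_comm_conj (rho_inv j).1 (cross_we' j i).
- by move=> i j; rewrite -!rhoEM bm_wf (linZ rhoE_lin).
- move=> i j; rewrite cross_fe opprD addrA subrr sub0r -scaleNr eq_sym.
  have -> : - ((i == j)%:R / (s - r)) = (i == j)%:R / (r - s).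
    by rewrite -mulrN -invrN opprB.
  by have [->|_] := eqVneq i j; rewrite ?mul0r ?scale0r.
- move=> i j ij; rewrite -(@ad_l_iter_morph _ _ B E bp double_gen lamE) //.
  + transitivity (lamE 0); last exact: lin0 lamE_lin.
    congr lamE; apply: val_inj.
    rewrite (@ad_l_iter_morph _ _ B (Uq t r s) bp G (val : B -> Uq t r s)) ?vp //.
    exact: (rel_serre_e UR).
  + exact: linB lamE_lin.
  + exact: lamEM.
- move=> i j ij; rewrite -(@ad_r_iter_morph _ _ B' E bm double_gen rhoE) //.
  + transitivity (rhoE 0); last exact: lin0 rhoE_lin.
    congr rhoE; apply: val_inj.
    rewrite (@ad_r_iter_morph _ _ B' (Uq t r s) bm G (val : B' -> Uq t r s)) ?vm //.
    exact: (rel_serre_f UR).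
  + exact: linB rhoE_lin.
  + exact: rhoEM.
Qed.

Local Notation C := (Ucore t r s).
Local Notation ug := (Usub_gen r s (@gens_both t)).

Let plus_both (g : gen t) : gens_plus g -> gens_both g.
Proof. by rewrite /gens_both => ->. Qed.
Let minus_both (g : gen t) : gens_minus g -> gens_both g.
Proof. by rewrite /gens_both orbC => ->. Qed.

Local Notation ip := (@Usub_incl K t r s (@gens_plus t) (@gens_both t)).
Local Notation im := (@Usub_incl K t r s (@gens_minus t) (@gens_both t)).

Let ipL := @Usub_incl_lin K t r s _ _ plus_both.
Let imL := @Usub_incl_lin K t r s _ _ minus_both.
Let ipM := @Usub_inclM K t r s _ _ plus_both.
Let imM := @Usub_inclM K t r s _ _ minus_both.
Let ip1 := @Usub_incl1 K t r s _ _ plus_both.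
Let im1 := @Usub_incl1 K t r s _ _ minus_both.
Let ip_gen g : gens_plus g -> ip (bp g) = ug g.
Proof. exact: (Usub_incl_gen r s plus_both). Qed.
Let im_gen g : gens_minus g -> im (bm g) = ug g.
Proof. exact: (Usub_incl_gen r s minus_both). Qed.

Let vu g : gens_both g -> val (ug g) = G g.
Proof. exact: val_Usub_gen. Qed.

Let ug_inv_w' i : ug (gw' i) * ug (gwV' i) = 1 /\ ug (gwV' i) * ug (gw' i) = 1.
Proof. by rewrite -!im_gen // -!imM (bm_inv i).1 (bm_inv i).2 im1. Qed.
Let ug_inv_w i : ug (gw i) * ug (gwV i) = 1 /\ ug (gwV i) * ug (gw i) = 1.
Proof. by rewrite -!ip_gen // -!ipM (bp_inv i).1 (bp_inv i).2 ip1. Qed.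

Let ug_toral g h : gens_both g -> gens_both h -> toral g -> toral h ->
  ug g * ug h = ug h * ug g.
Proof.
by move=> *; apply: val_inj; rewrite !Usub_valM !vu //; exact: (rel_toral UR).
Qed.

Let ug_w'e i j : ug (gw' j) * ug (ge i) = (sc t r s j i)^-1 *: (ug (ge i) * ug (gw' j)).
Proof.
apply: conj_skew_comm (ug_inv_w' j).2 _; apply: val_inj.
by rewrite UvalZ !Usub_valM !vu //; exact: (rel_we' UR).
Qed.
Let ug_wf i j : ug (gw j) * ug (gf i) = (sc t r s i j)^-1 *: (ug (gf i) * ug (gw j)).
Proof.
apply: conj_skew_comm (ug_inv_w j).2 _; apply: val_inj.
by rewrite UvalZ !Usub_valM !vu //; exact: (rel_wf UR).
Qed.
Let ug_ef (i j : node t) : ug (ge i) * ug (gf j) - ug (gf j) * ug (ge i) =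
  ((i == j)%:R / (r - s)) *: (ug (gw i) - ug (gw' i)).
Proof.
apply: val_inj; rewrite UvalZ.
have vB (a b : C) : val (a - b) = val a - val b by [].
by rewrite !vB !Usub_valM !vu //; exact: (rel_ef UR).
Qed.

Let toral_past h a : gens_minus h -> toral h ->
  exists b, ug h * ip a = ip b * ug h.
Proof.
move=> mh th; elim/Usub_ind: a => [|k a b [a' ha] [b' hb]|a b [a' ha] [b' hb]|g a Pg].
- by exists 1; rewrite ip1 mulr1 mul1r.
- exists (k *: a' + b'); rewrite !ipL mulrDr mulrDl -scalerAr ha hb.
  by rewrite scalerAl.
- by exists (a' * b'); rewrite !ipM mulrA ha -mulrA hb mulrA.
- move/Usub_genP => -> //; rewrite ip_gen //.
  have [tg|] := boolP (toral g).
    by exists (bp g); rewrite ip_gen //; apply: ug_toral; auto.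
  case: g Pg => // j _ _; case: h mh th => // i _ _.
    exists ((sc t r s i j)^-1 *: bp (ge j)).
    by rewrite (linZ ipL) ip_gen // ug_w'e scalerAl.
  exists (((sc t r s i j)^-1)^-1 *: bp (ge j)).
  rewrite (linZ ipL) ip_gen // -scalerAl.
  exact: skew_comm_inv (invr_neq0 (sc_neq0 i j)) (ug_inv_w' i).1 (ug_inv_w' i).2
    (ug_w'e j i).
Qed.

(* The span on the right is stable under right multiplication by B, and it
   contains the products of f_i with the generators of B. *)
Let f_past i a : exists b1 b2 b3,
  ug (gf i) * ip a = ip b1 + ip b2 * ug (gf i) + ip b3 * ug (gw' i).
Proof.
elim/Usub_ind: a => [|k a b [a1 [a2 [a3 ha]]] [b1 [b2 [b3 hb]]]|
    a b [a1 [a2 [a3 ha]]] [b1 [b2 [b3 hb]]]|g a Pg].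
- by exists 0, 1, 0; rewrite (lin0 ipL) ip1 mulr1 mul1r mul0r addr0 add0r.
- exists (k *: a1 + b1), (k *: a2 + b2), (k *: a3 + b3).
  rewrite !ipL mulrDr -scalerAr ha hb !mulrDl -!scalerAl !scalerDr.
  by rewrite addrACA; congr (_ + _); rewrite addrACA.
- have [b' hb'] := toral_past b (h := gw' i) erefl erefl.
  exists (a1 * b + a2 * b1), (a2 * b2), (a2 * b3 + a3 * b').
  rewrite !(linD ipL) !ipM mulrA ha !mulrDl -!mulrA hb hb' !mulrDr !mulrA.
  by rewrite -!addrA.
- move/Usub_genP => -> //; rewrite ip_gen //; case: g Pg => // j _.
  (* where the coefficient is not zero, w'_j is w'_i *)
  + exists (- (((j == i)%:R / (r - s)) *: bp (gw j))), (bp (ge j)),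
      (((j == i)%:R / (r - s)) *: 1).
    rewrite (linN ipL) !(linZ ipL) !ip_gen // ip1 -scalerAl mul1r.
    have := ug_ef j i; move/eqP; rewrite subr_eq => /eqP ->.
    have -> : ((j == i)%:R / (r - s)) *: ug (gw' i) =
              ((j == i)%:R / (r - s)) *: ug (gw' j).
      by have [->|_] := eqVneq j i; rewrite // !mul0r !scale0r.
    by rewrite scalerBr !addrA addNr sub0r addrAC addNr add0r.
  + have hf : ug (gf i) * ug (gw j) = sc t r s i j *: (ug (gw j) * ug (gf i)).
      by rewrite ug_wf scalerA mulfV ?scale1r.
    exists 0, (sc t r s i j *: bp (gw j)), 0.
    by rewrite (lin0 ipL) (linZ ipL) ip_gen // add0r mul0r addr0 -scalerAl.
  + have hf := skew_comm_inv (invr_neq0 (sc_neq0 i j)) (ug_inv_w j).1 (ug_inv_w j).2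
      (ug_wf i j).
    exists 0, ((sc t r s i j)^-1 *: bp (gwV j)), 0.
    rewrite (lin0 ipL) (linZ ipL) ip_gen // add0r mul0r addr0 -scalerAl hf invrK.
    by rewrite scalerA mulVf ?scale1r.
Qed.

Let psi : T -> C := tlift (fun a f => ip a * im f).
Let psi_bilin : bilin (fun a f => ip a * im f).
Proof. by split=> ? k u v; rewrite ?ipL ?imL ?mulrDl ?mulrDr -?scalerAl -?scalerAr. Qed.
Let psiL : linear psi := tlift_lin psi_bilin.
Let psi_tens a f : psi (tensor a f) = ip a * im f := tlift_tens a f psi_bilin.

Let psi_surj u : exists m, u = psi m.
Proof.
suff: forall m, exists m', u * psi m = psi m'.
  move=> /(_ (tensor 1 1)) [m]; rewrite psi_tens ip1 im1 !mulr1 => ->.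
  by exists m.
have RS (F : B -> B' -> C) m : (forall a g, exists m', F a g = psi m') ->
    exists m', tlift F m = psi m'.
  move=> h; rewrite tliftE; elim: (repr m) => [|q l [m' IH]].
    by exists 0; rewrite big_nil (lin0 psiL).
  have [m'' h'] := h q.1 q.2; exists (m'' + m').
  by rewrite big_cons h' IH (linD psiL).
elim/Usub_ind: u => [|k a b ha hb|a b ha hb|g u Pg uE] m.
- by exists m; rewrite mul1r.
- have [ma ea] := ha m; have [mb eb] := hb m; exists (k *: ma + mb).
  by rewrite psiL mulrDl -scalerAl ea eb.
- have [mb eb] := hb m; have [ma ea] := ha mb; exists ma.
  by rewrite -mulrA eb.
rewrite (Usub_genP Pg uE).
have mul_lin : linear (fun x : C => ug g * x).
  by move=> k x y; rewrite mulrDr scalerAr.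
rewrite (tlift_comp _ _ mul_lin); apply: RS => a h.
have [pg|npg] := boolP (gens_plus g).
  by exists (tensor (bp g * a) h); rewrite psi_tens ipM ip_gen // mulrA.
have mg : gens_minus g by move: Pg npg; rewrite /gens_both; case: gens_plus.
have [tg|] := boolP (toral g).
  have [b hb] := toral_past a mg tg; exists (tensor b (bm g * h)).
  by rewrite psi_tens imM im_gen // mulrA hb mulrA.
case: g mg {mul_lin Pg npg uE} => // i _ _.
have [b1 [b2 [b3 hb]]] := f_past i a.
exists (tensor b1 h + tensor b2 (bm (gf i) * h) + tensor b3 (bm (gw' i) * h)).
rewrite !(linD psiL) !psi_tens !imM !im_gen // mulrA hb !mulrDl !mulrA.
by [].
Qed.

(** As F (psi m) is left multiplication by m in the double, evaluating F at
    the unit inverts psi and is multiplicative. *)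
Theorem core_double_iso :
  hopf_isomorphic (ops_of HU) (drinfeld_double HB HB' p).
Proof.
have [F [FL F1 FM Fgen]] := core_universal r_neq0 s_neq0 double_core_rel.
have Fp a : F (ip a) = lamE a.
  elim/Usub_ind: a => [|k a b ha hb|a b ha hb|g a Pg].
  - by rewrite ip1 F1 lamE1.
  - by rewrite ipL FL ha hb lamE_lin.
  - by rewrite ipM FM ha hb lamEM.
  - move/Usub_genP => -> //; rewrite ip_gen // (Fgen g) ?vu; auto.
    by rewrite /double_gen Pg.
have Fm a : F (im a) = rhoE a.
  elim/Usub_ind: a => [|k a b ha hb|a b ha hb|g a Pg].
  - by rewrite im1 F1 rhoE1.
  - by rewrite imL FL ha hb rhoE_lin.
  - by rewrite imM FM ha hb rhoEM.
  - move/Usub_genP => -> //; rewrite im_gen // (Fgen g) ?vu; auto.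
    by rewrite /double_gen; case: g Pg.
pose dm := double_mul HB HB' p.
have Fpsi m x : F (psi m) x = dm m x.
  rewrite /dm (double_mulE p_skew).
  have ev : linear (fun u => F u x) by move=> k u v; rewrite FL.
  rewrite (tlift_comp _ _ ev); apply: eq_tlift => a f.
  by rewrite FM Fp Fm.
pose phi u : T := F u (tensor 1 1).
have phiL : linear phi by move=> k u v; rewrite /phi FL.
have phi_psi m : phi (psi m) = m.
  rewrite /phi Fpsi /dm (double_mulE p_skew) [RHS]tens_sum tliftE.
  by apply: eq_bigr => q _; rewrite lam_rho_unit.
have phi_tens a f : phi (ip a * im f) = tensor a f by rewrite -psi_tens phi_psi.
have phiM u v : phi (u * v) = dm (phi u) (phi v).
  by have [m ->] := psi_surj u; rewrite phi_psi -Fpsi /phi FM.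
have sat_p i : [/\ gens_plus (@ge t i) -> gens_plus (@gw t i),
    gens_plus (@gf t i) -> gens_plus (@gw' t i),
    gens_plus (@gw t i) = gens_plus (@gwV t i)
  & gens_plus (@gw' t i) = gens_plus (@gwV' t i)] by [].
have sat_m i : [/\ gens_minus (@ge t i) -> gens_minus (@gw t i),
    gens_minus (@gf t i) -> gens_minus (@gw' t i),
    gens_minus (@gw t i) = gens_minus (@gwV t i)
  & gens_minus (@gw' t i) = gens_minus (@gwV' t i)] by [].
have hp := incl_hopf plus_both HB_std HU_std plus_both sat_p.
have hm := incl_hopf minus_both HB'_std HU_std minus_both sat_m.
have dmL x : linear (dm x).
  move=> k u v; rewrite /dm !(double_mulE p_skew) !tliftE; linsum1.
  by rewrite (rho_linr p_skew) lam_lin.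
have dmLl y : linear (dm^~ y).
  have bb : bilin (fun a f => lam a (rho HB HB' p f y)).
    split=> ? k u v; first by rewrite lam_linl.
    by rewrite (rho_linl p_skew) lam_lin.
  by move=> k u v; rewrite /dm !(double_mulE p_skew) (tlift_lin bb).
pose phi' : {linear C -> T} := HB.pack phi (GRing.isLinear.Build _ _ _ _ phi phiL).
exists phi'; split.
- exists psi => [u|m] /=; last exact: phi_psi.
  by have [m ->] := psi_surj u; rewrite phi_psi.
- split=> [|u v]; last exact: phiM.
  by rewrite /= -phi_tens ip1 im1 mulr1.
- move=> u; have [m ->] := psi_surj u; rewrite [phi' _]phi_psi /=.
  pose D (a1 a2 : B) (f1 f2 : B') : tens T T := tensor (tensor a1 f1) (tensor a2 f2).
  have Df a1 a2 : bilin (D a1 a2).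
    by split=> ? k x y; rewrite /D ?tensorLr ?tensorLl ?tensorLr.
  have Da X : bilin (fun a1 a2 => tlift (D a1 a2) X).
    by split=> ? k x y; rewrite !tliftE; linsum1; rewrite /D !tensorLl ?tensorLr.
  have dbil : bilin (fun a f => tlift (fun a1 a2 => tlift (D a1 a2) (cop HB' f))
      (cop HB a)).
    split=> [f|a k f g]; first exact: (@cop_tlift_lin _ _ HB _ _ (Da _)).
    rewrite !tliftE; linsum1.
    exact: (@cop_tlift_lin _ _ HB' _ _ (Df _ _) k f g).
  move: m; apply: tens_linE => [|k x y|a f].
  + exact: tlift_lin dbil.
  + by rewrite psiL cop_lin (tmap_lin phiL phiL).
  rewrite psi_tens copM /double_cop (tlift_tens _ _ dbil).
  have [-> _ _] := hp a; have [-> _ _] := hm f.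
  rewrite /tmul tlift_tmap; last first.
    split=> ? k u' v; rewrite !tliftE; linsum1;
      by rewrite mulrDl -scalerAl ?tensorLl ?tensorLr.
  rewrite (tlift_comp _ _ (tmap_lin phiL phiL)); apply: eq_tlift => a1 a2.
  rewrite tlift_tmap; last first.
    by split=> ? k u' v; rewrite mulrDr -scalerAr ?tensorLl ?tensorLr.
  rewrite (tlift_comp _ _ (tmap_lin phiL phiL)); apply: eq_tlift => f1 f2.
  by rewrite (tmap_tens _ _ phiL phiL) !phi_tens.
- move=> u; have [m ->] := psi_surj u; rewrite [phi' _]phi_psi /=.
  have ebil : bilin (fun a f => (eps HB a * eps HB' f : K^o)).
    split=> ? k x y; rewrite eps_lin; first by rewrite mulrDl -mulrA.
    by rewrite mulrDr mulrCA.
  move: m; apply: (@tens_linE _ _ _ (K^o : lmodType K)) => [|k x y|a f].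
  + exact: tlift_lin ebil.
  + by rewrite psiL eps_lin.
  rewrite psi_tens epsM /double_eps (tlift_tens _ _ ebil).
  by have [_ -> _] := hp a; have [_ -> _] := hm f.
- move=> u; have [m ->] := psi_surj u; rewrite [phi' _]phi_psi /=.
  have abil : bilin (fun a f => dm (tensor 1 (ant HB' f)) (tensor (ant HB a) 1)).
    split=> ? k x y; rewrite ant_lin; first by rewrite tensorLl dmL.
    by rewrite tensorLr dmLl.
  move: m; apply: tens_linE => [|k x y|a f].
  + exact: tlift_lin abil.
  + by rewrite psiL ant_lin phiL.
  rewrite psi_tens antM /double_ant (tlift_tens _ _ abil) phiM.
  have [_ _ ->] := hp a; have [_ _ ->] := hm f.
  congr dm; first by rewrite -phi_tens ip1 mul1r.
  by rewrite -phi_tens im1 mulr1.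
Qed.
End Comparison.

Theorem theorem2p8 (K : closedFieldType) (charK : [pchar K] =i pred0)
    (r s : K) (r_neq0 : r != 0) (s_neq0 : s != 0) (rs_neq : r ^+ 2 != s ^+ 2)
    (t : aff_type) (t_ok : aff_ok t)
    (HU : hopfAlg (Ucore t r s)) (HU_std : std_hopf HU)
    (HB : hopfAlg (Bplus t r s)) (HB_std : std_hopf HB)
    (HB' : hopfAlg (Bminus t r s)) (HB'_std : std_hopf HB')
    (p : Bminus t r s -> Bplus t r s -> K)
    (p_skew : skew_dual_pairing HB HB' p) (p_std : std_pairing p) :
  hopf_isomorphic (ops_of HU) (drinfeld_double HB HB' p).
Proof. exact: core_double_iso. Qed.
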